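(* Every right pseudogalaxy satisfies the Erdős–Hajnal Conjecture: for every right pseudogalaxy $H$ there exists $\epsilon(H)>0$ such that every tournament $T$ not containing $H$ as a subtournament contains a transitive subtournament on at least $|T|^{\epsilon(H)}$ vertices.
   Context: Tournaments are finite; subtournament = induced subtournament; transitive = no directed cycle. Given an ordering of the vertex set of a tournament, an edge $(x,y)$ is backward if $y$ precedes $x$; a tournament with an ordered vertex set is determined by its set of backward edges. For a tournament $T$ and ordering $\theta=(v_1,\dots,v_n)$ of $V(T)$, $B(T,\theta)$ is the undirected graph on $V(T)$ in which $v_iv_j$ is an edge iff the edge between $v_i,v_j$ is backward. A right star is an induced subgraph of $B(T,\theta)$ on $\{v_{i_0},\dots,v_{i_t}\}$ which is a star $K_{1,t}$ with center $v_{i_t}$ and $i_t>i_0,\dots,i_{t-1}$; a left star is one that is a star with center $v_{i_0}$ and $i_0<i_1,\dots,i_t$ (for $t=1$ either vertex may be regarded as the center). $T$ is a galaxy if some ordering $\theta$ (a galaxy ordering) has every connected component of $B(T,\theta)$ a left star, a right star, or a singleton, and no center of a star lies in the ordering between two leaves of another star; the non-singleton components are the stars of $T$. Product: for tournaments $H_1,H_2$ with disjoint vertex sets and injective $f_1:V(H_1)\to\mathbb{N}$, $f_2:V(H_2)\to\mathbb{N}$ with disjoint images, let $\theta_i$ order $V(H_i)$ by increasing $f_i$ and $\theta$ order $V(H_1)\cup V(H_2)$ by increasing value of $f_1$ on $V(H_1)$ and $f_2$ on $V(H_2)$; $H_1^{f_1}\oplus H_2^{f_2}$ is the tournament on $V(H_1)\cup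 V(H_2)$ whose backward edges under $\theta$ are exactly those of $H_1$ under $\theta_1$ together with those of $H_2$ under $\theta_2$. Right pseudogalaxy: let $H_l$ have vertices $h_1,\dots,h_7$ and backward edges under $(h_1,\dots,h_7)$ exactly $(h_4,h_1),(h_6,h_2),(h_6,h_1),(h_5,h_3),(h_7,h_5)$. Let $G$ be a galaxy with galaxy ordering $(g_1,\dots,g_r)$ and let $1\le s\le r$ be such that no star of $G$ has one leaf in $\{g_1,\dots,g_s\}$ and another leaf in $\{g_{s+1},\dots,g_r\}$. Let $\rho_1(h_i)=i$ for $i=1,\dots,6$, $\rho_1(h_7)=7+s$; $\rho_2(g_u)=6+u$ for $u\le s$ and $\rho_2(g_u)=7+u$ for $u>s$. Then $H=H_l^{\rho_1}\oplus G^{\rho_2}$ is a right pseudogalaxy. *)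

(* Defs.v *)
From HB Require Import structures.
From mathcomp Require Import all_boot all_order all_algebra.
From mathcomp Require Import reals exp zify.

Set Implicit Arguments.
Unset Strict Implicit.
Unset Printing Implicit Defensive.

Import Order.TTheory GRing.Theory Num.Theory.

Record tournament := Tournament {
  vertex :> finType;
  edge : rel vertex;
  edge_irr : irreflexive edge;
  edge_xor : forall x y, x != y -> edge x y (+) edge y x }.

Definition isomorphic (H K : tournament) : Prop :=
  exists2 phi : H -> K, bijective phi & {mono phi : x y / edge x y}.

Section Induced.
Variables (T : tournament) (S : {set T}).

Definition induced_edge : rel {x | x \in S} :=
  fun x y => edge (val x) (val y).

Lemma induced_irr : irreflexive induced_edge.
Proof. by move=> x; apply: edge_irr. Qed.

Lemma induced_xor x y :
  x != y -> induced_edge x y (+) induced_edge y x.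
Proof. by move=> xy; apply: edge_xor. Qed.

Definition subtournament : tournament := Tournament induced_irr induced_xor.

End Induced.

Definition contains (T H : tournament) : Prop :=
  exists S : {set T}, isomorphic H (subtournament S).

Definition transitive_tournament (T : tournament) : Prop :=
  forall c : seq T, ucycle (@edge T) c -> c = [::].

Definition erdos_hajnal (R : realType) (H : tournament) : Prop :=
  exists2 eps : R, (0 < eps)%R &
    forall T : tournament, ~ contains T H ->
      exists2 S : {set T}, transitive_tournament (subtournament S) &
        (#|T|%:R `^ eps <= #|S|%:R :> R)%R.

(* An ordering of V enters the notions below through an injective rank
   r : V -> nat, with x preceding y iff r x < r y. *)

Definition backward (T : tournament) (r : T -> nat) : rel T :=
  fun x y => edge x y && (r y < r x).

Section OfBackward.
Variables (V : finType) (r : V -> nat) (B : rel V).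
Hypothesis r_inj : injective r.

(* Only the pairs (x, y) of B with r y < r x are used. *)
Definition of_backward_edge : rel V :=
  fun x y => if r x < r y then ~~ B y x else (r y < r x) && B x y.

Lemma of_backward_irr : irreflexive of_backward_edge.
Proof. by move=> x; rewrite /of_backward_edge ltnn. Qed.

Lemma of_backward_xor x y :
  x != y -> of_backward_edge x y (+) of_backward_edge y x.
Proof.
rewrite -(inj_eq r_inj) /of_backward_edge.
by case: ltngtP => //= _ _; case: (B _ _).
Qed.

Definition of_backward : tournament :=
  Tournament of_backward_irr of_backward_xor.

End OfBackward.

Section Product.
Variables (H1 H2 : tournament) (f1 : H1 -> nat) (f2 : H2 -> nat).
Hypotheses (f1_inj : injective f1) (f2_inj : injective f2).
Hypothesis f12_disj : forall x y, f1 x != f2 y.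

Definition product_rank (x : H1 + H2) : nat :=
  match x with inl a => f1 a | inr b => f2 b end.

Definition product_backward : rel (H1 + H2) := fun x y =>
  match x, y with
  | inl a, inl b => backward f1 a b
  | inr a, inr b => backward f2 a b
  | _, _ => false
  end.

Lemma product_rank_inj : injective product_rank.
Proof.
move=> [a|a] [b|b] /= /eqP; rewrite ?(inj_eq f1_inj) ?(inj_eq f2_inj).
- by move/eqP->.
- by rewrite (negPf (f12_disj _ _)).
- by rewrite eq_sym (negPf (f12_disj _ _)).
- by move/eqP->.
Qed.

Definition product : tournament :=
  of_backward product_backward product_rank_inj.

End Product.

Section Galaxy.
Variables (T : tournament) (r : T -> nat).

Definition backgraph : rel T :=
  fun x y => backward r x y || backward r y x.

Definition components : {set {set T}} :=
  [set [set y | connect backgraph x y] | x in T].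

Definition stars : {set {set T}} := [set K in components | 1 < #|K|].

(* K induces in the backward graph a star K_{1,t} with t >= 1 and center c. *)
Definition induced_star (K : {set T}) (c : T) : Prop :=
  [/\ c \in K, 1 < #|K| &
      {in K &, forall u v, backgraph u v = (u != v) && ((u == c) || (v == c))}].

Definition left_star (K : {set T}) (c : T) : Prop :=
  induced_star K c /\ {in K, forall v, v != c -> r c < r v}.

Definition right_star (K : {set T}) (c : T) : Prop :=
  induced_star K c /\ {in K, forall v, v != c -> r v < r c}.

(* C collects the centers of the stars, one for each star; it records which
   vertex of a two-vertex star is regarded as its center. The leaves of a star
   K are the elements of K :\: C. *)
Definition galaxy_centers (C : {set T}) : Prop :=
  (forall K, K \in components ->
     #|K| = 1 \/
     exists2 c, K :&: C = [set c] & left_star K c \/ right_star K c) /\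
  (forall K L, K \in stars -> L \in stars -> K != L ->
     forall c x y, c \in K :&: C -> x \in L :\: C -> y \in L :\: C ->
       ~ (r x < r c < r y)).

End Galaxy.

Definition ordering (T : tournament) (theta : seq T) : Prop :=
  uniq theta /\ forall x, x \in theta.

Definition position (T : tournament) (theta : seq T) (x : T) : nat :=
  (index x theta).+1.

Definition galaxy_ordering (T : tournament) (theta : seq T) (C : {set T}) :
    Prop :=
  ordering theta /\ galaxy_centers (position theta) C.

(* The vertex h_k is the ordinal k.-1. *)
Definition Hl_rank (h : 'I_7) : nat := h.+1.

Definition Hl_backward : rel 'I_7 := fun x y =>
  (Hl_rank x, Hl_rank y) \in [:: (4, 1); (6, 2); (6, 1); (5, 3); (7, 5)].

Lemma Hl_rank_inj : injective Hl_rank.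
Proof. by move=> x y [] /val_inj. Qed.

Definition Hl : tournament := of_backward Hl_backward Hl_rank_inj.

Section RightPseudogalaxy.
Variables (G : tournament) (theta : seq G) (s : nat).
Hypothesis theta_ord : ordering theta.

Definition rho1 (h : Hl) : nat :=
  if Hl_rank h <= 6 then Hl_rank h else 7 + s.

Definition rho2 (g : G) : nat :=
  if position theta g <= s then 6 + position theta g else 7 + position theta g.

Lemma rho1_inj : injective rho1.
Proof.
move=> x y; rewrite /rho1 => exy; apply: Hl_rank_inj; move: exy.
have [] : Hl_rank x <= 7 /\ Hl_rank y <= 7 by split; apply: ltn_ord.
move: (Hl_rank x) (Hl_rank y) => p q.
by case: (leqP p 6); case: (leqP q 6); lia.
Qed.

Lemma rho2_inj : injective rho2.
Proof.
move=> x y exy; have epos : position theta x = position theta y.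
  move: exy; rewrite /rho2.
  move: (position theta x) (position theta y) => p q.
  by case: (leqP p s); case: (leqP q s); lia.
case: epos => epos.
by rewrite -(nth_index x (theta_ord.2 x)) epos nth_index ?theta_ord.2.
Qed.

Lemma rho12_disj h g : rho1 h != rho2 g.
Proof.
have : 0 < position theta g by [].
rewrite /rho1 /rho2; move: (Hl_rank h) (position theta g) => p q.
by case: (leqP p 6); case: (leqP q s); lia.
Qed.

Definition right_pseudogalaxy_of : tournament :=
  product rho1_inj rho2_inj rho12_disj.

End RightPseudogalaxy.

Definition right_pseudogalaxy (H : tournament) : Prop :=
  exists (G : tournament) (theta : seq G) (C : {set G}) (s : nat)
         (Gord : galaxy_ordering theta C),
    [/\ 1 <= s <= #|G|,
        (forall K, K \in stars (position theta) ->
           forall x y, x \in K :\: C -> y \in K :\: C ->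
             ~ (position theta x <= s < position theta y)) &
        isomorphic H (right_pseudogalaxy_of s Gord.1)].

(* Main.v *)
(* Let T be H-free and suppose that, for a suitable constant K and a small
   exponent, V is a minimal set of vertices with no transitive set of size
   |V|^eps. If t is the largest size of a transitive set in V, every B in V with
   |B| >= |V|/K contains a transitive set of size almost t. So no such B is
   complete to or from a transitive set of more than t/K vertices, nor to or
   from another set of at least |V|/K vertices: backward edges exist between
   all large parts.

   Since T is H-free, greedy embedding fails, and V contains arbitrarily many
   disjoint linear-size parts A_0, A_1, ... with almost all edges between them
   directed forward. A star is found by taking its center in one part and its
   leaves in consecutive pieces of a transitive set inside another part; a
   galaxy is embedded star by star, the leaves between two successive centers
   sharing one transitive set.

   In H_l, the backward edges form the paths 4-1-6-2 and 3-5-7, which are not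
   stars. But H_l also has the ordering 2,4,1,5,3,6,7, whose backward edges are
   the triangle 2,1,6 and the edges 3-4 and 5-7. Hence a triangle of backward
   edges yields H. Without such triangles, take 2,3,4 in a transitive set and
   1,5,6,7 in separate parts: the pairs 1,2 and 4,6 and 3,7 must be forward. *)

Require Import Defs.
From mathcomp Require Import all_boot all_order all_algebra.
From mathcomp Require Import reals exp.
From mathcomp Require Import sequences zify.

Set Implicit Arguments.
Unset Strict Implicit.
Unset Printing Implicit Defensive.

Import Order.TTheory GRing.Theory Num.Theory.

(** * Chains as transitive sets, and embeddings *)

Section Basics.
Variable T : tournament.
Implicit Types (x y : T) (A B V : {set T}) (s : seq T).

Lemma edgeN x y : x != y -> edge x y = ~~ edge y x.
Proof. by move=> /edge_xor; case: edge; case: edge. Qed.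

Lemma edge_asym x y : edge x y -> ~~ edge y x.
Proof.
by case: (eqVneq x y) => [->|/edgeN ->]; rewrite ?edge_irr.
Qed.

(** A transitive set is handled as the list of its vertices in transitive order, so that two of them
    with all edges from the first to the second merge by concatenation. *)
Definition chain V s := pairwise (@edge T) s && all [in V] s.

Lemma chain_cat V s1 s2 :
  chain V (s1 ++ s2) = [&& chain V s1, chain V s2 & allrel (@edge T) s1 s2].
Proof.
rewrite /chain pairwise_cat all_cat.
by case: allrel; case: pairwise; case: pairwise; case: all; case: all.
Qed.

Lemma chain_sub V B s : chain V s -> {subset s <= B} -> chain B s.
Proof. by case/andP=> ps _ sB; rewrite /chain ps; apply/allP. Qed.

Lemma chain_filter V s p : chain V s -> chain V (filter p s).
Proof.
case/andP=> ps sV; apply/andP; split; first exact: pairwise_filter.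
by apply/allP => x; rewrite mem_filter => /andP[_ /(allP sV)].
Qed.

Lemma chain_uniq V s : chain V s -> uniq s.
Proof. by case/andP=> ps _; apply: pairwise_uniq ps; apply: edge_irr. Qed.

Lemma chain_card V s : chain V s -> size s <= #|V|.
Proof.
move=> cs; rewrite cardE; apply: uniq_leq_size; first exact: chain_uniq cs.
by move=> x xs; rewrite mem_enum; case/andP: cs => _ /allP; apply.
Qed.

Lemma chain_index V s x y :
  chain V s -> x \in s -> y \in s -> edge x y -> index x s < index y s.
Proof.
move=> /andP[/(pairwiseP x) ps _] xs ys exy; rewrite ltnNge; apply/negP => le.
have: index x s != index y s.
  apply/eqP => e; have := exy.
  by rewrite -(nth_index x xs) -(nth_index x ys) e edge_irr.
rewrite neq_ltn ltnNge le /= => lt.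
have := ps (index y s) (index x s); rewrite !inE !index_mem !nth_index //.
by move=> /(_ ys xs lt) /edge_asym; rewrite exy.
Qed.

Lemma chain_transitive V s :
  chain V s -> transitive_tournament (subtournament [set x in s]).
Proof.
move=> cs [//|x c] /andP[cyc _]; exfalso.
pose f (z : {x | x \in [set x in s]}) := index (val z) s.
have fE (z : {x | x \in [set x in s]}) : val z \in s.
  by case: z => z /= zs; rewrite inE in zs.
have: path (relpre f ltn) x (rcons c x).
  apply: sub_path cyc => u v; rewrite /= /induced_edge => euv.
  exact: (chain_index cs).
have tr : transitive (relpre f ltn) by move=> u v w /=; apply: ltn_trans.
move/(order_path_min tr); rewrite all_rcons => /andP[/=].
by rewrite ltnn.
Qed.

(** Injectivity is automatic: distinct vertices are joined by an edge, and no vertex is joined to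
    itself. *)
Lemma contains_embed (H : tournament) (phi : H -> T) :
  {mono phi : x y / edge x y} -> contains T H.
Proof.
move=> mphi.
have inj : injective phi.
  move=> x y e; apply/eqP; apply/negPn/negP => /edge_xor.
  by rewrite -!mphi e edge_irr.
pose S := [set phi x | x in H].
have phiS (x : H) : phi x \in S by apply: imset_f.
pose psi (x : H) : subtournament S := exist _ (phi x) (phiS x).
exists S, psi => //; apply: inj_card_bij => [x y [] /inj //|].
by rewrite card_sig card_imset // -cardE.
Qed.

(** Of the out- and in-neighbours of a vertex, one set is large enough for induction; the vertex is
    then put in front of the chain found there, or behind it. *)
Lemma ramsey_chain k V : 2 ^ k <= #|V| -> exists2 s, chain V s & k < size s.
Proof.
elim: k V => [|k IHk] V kV; have /card_gt0P[v vV] : 0 < #|V|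
    by apply: leq_trans kV; rewrite expn_gt0.
  by exists [:: v]; rewrite // /chain /= vV.
pose O := [set x in V | edge v x]; pose I := [set x in V | edge x v].
have VE : V = v |: (O :|: I).
  apply/setP => x; rewrite !inE; case: eqVneq => [->|/edgeN ->] //=.
  by case: (x \in V); case: (edge v x).
have : #|V| <= 1 + (#|O| + #|I|).
  rewrite {1}VE; apply: leq_trans (leq_card_setU _ _) _.
  by rewrite cards1 leq_add2l leq_card_setU.
move: kV; rewrite expnS => kV VOI.
have [kO|kO] := leqP (2 ^ k) #|O|.
  have [s cs ks] := IHk _ kO; exists (v :: s) => //.
  case/andP: cs => ps sO; rewrite /chain /= ps vV /= andbT.
  apply/andP; split; apply: sub_all sO => x; rewrite inE => /andP[] //.
have kI : 2 ^ k <= #|I| by lia.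
have [s cs ks] := IHk _ kI; exists (rcons s v); last by rewrite size_rcons.
case/andP: cs => ps sI; rewrite /chain pairwise_rcons ps all_rcons vV /= andbT.
by apply/andP; split; apply: sub_all sI => x; rewrite inE => /andP[].
Qed.

End Basics.

(** * Sparse pairs *)

Definition orient (T : tournament) (b : bool) (x y : T) :=
  if b then edge x y else edge y x.

Section SparsePairs.
Variable T : tournament.
Implicit Types A B V : {set T}.

Lemma split_sets (I : eqType) (l : seq I) q V :
  uniq l -> size l * q <= #|V| ->
  exists W : I -> {set T},
    {in l, forall i, W i \subset V /\ #|W i| = q} /\
    {in l &, forall i j, i != j -> [disjoint W i & W j]}.
Proof.
elim: l V => [|i l IHl] V /=; first by move=> _ _; exists (fun _ => set0).
case/andP=> il ul; rewrite mulSn => lq.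
pose P := [set x in take q (enum V)].
have cP : #|P| = q.
  rewrite cardsE (card_uniqP (take_uniq _ (enum_uniq V))) size_take_min -cardE.
  by apply/minn_idPl; lia.
have PV : P \subset V.
  by apply/subsetP => x; rewrite inE => /mem_take; rewrite mem_enum.
have cD : #|V :\: P| = #|V| - q by rewrite cardsD (setIidPr PV) cP.
have [W [WV Wd]] := IHl (V :\: P) ul ltac:(lia).
have nW j : j \in l -> (j == i) = false.
  by move=> jl; apply: contraNF il => /eqP <-.
have dP j : j \in l -> [disjoint P & W j].
  move=> /WV[/subsetP WjV _]; apply/pred0P => x /=.
  by apply/negP => /andP[xP /WjV]; rewrite inE xP.
exists (fun j => if j == i then P else W j); split.
  move=> j; rewrite inE; case: eqP => [_ //|_ /= /WV[WjV ?]].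
  by split=> //; apply: subset_trans WjV (subsetDl _ _).
move=> j k; rewrite !inE.
case: (eqVneq j i) => [->|ji]; case: (eqVneq k i) => [->|ki] //=.
- by move=> _ /dP.
- by move=> /dP; rewrite disjoint_sym.
- by apply: Wd.
Qed.

(** Greedy embedding: the first vertex is sent to some [v] that leaves a fraction [1 / M] of every
    other [W j] usable, and the parts shrink accordingly; [M ^ size hs] pays for this. The factor
    [h] pays for the pigeonhole used when no such [v] exists. *)
Lemma embed_or_sparse (H : tournament) (hs : seq H) (x0 : T)
    (W : H -> {set T}) M m h :
  uniq hs -> 0 < M -> 0 < m -> size hs <= h ->
  {in hs, forall j, m * h * M ^ size hs <= #|W j|} ->
  (exists phi : H -> T, {in hs, forall i, phi i \in W i} /\
     {in hs &, forall i j, i != j -> edge (phi i) (phi j) = edge i j}) \/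
  (exists i j A B, [/\ i \in hs, j \in hs & i != j] /\
     [/\ A \subset W i, B \subset W j, m <= #|A| & m <= #|B|] /\
     exists b, {in A, forall x, M * #|[set y in B | orient b x y]| <= #|B|}).
Proof.
move=> uh M0 m0; elim: hs uh W => [|i hs IH] /=.
  move=> _ W _ _; left.
  by exists (fun _ => x0).
case/andP=> ih uh W hsh Wc.
have Wpow j : j \in i :: hs -> m * h <= #|W j|.
  by move=> /Wc; apply: leq_trans; rewrite leq_pmulr // expn_gt0 M0.
pose N v j := [set u in W j | orient (edge i j) v u].
have [/existsP[v /andP[vW /allP vg]]|] :=
    boolP [exists v, (v \in W i) && all (fun j => #|W j| <= M * #|N v j|) hs].
  have [j jh|[phi [phiW phiE]]|] := IH uh (N v) (ltnW hsh).
  - have := vg j jh; have := Wc j; rewrite inE jh orbT => /(_ isT).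
    rewrite expnS mulnCA => le1 le2.
    by rewrite -(leq_pmul2l M0); apply: leq_trans le1 le2.
  - left; exists (fun j => if j == i then v else phi j).
    have nW j : j \in hs -> (j == i) = false.
      by move=> jl; apply: contraNF ih => /eqP <-.
    have phiN j : j \in hs -> phi j \in W j /\ orient (edge i j) v (phi j).
      by move=> /phiW; rewrite inE => /andP[].
    split=> [j|j k]; rewrite !inE.
      by case: eqP => [->|_ /= /phiN[]].
    case: (eqVneq j i) => [->|ji]; case: (eqVneq k i) => [->|ki] //=.
    + move=> _ /phiN[_]; rewrite /orient; case: (edge i k) => // /edge_asym.
      by move/negPf.
    + move=> /phiN[_]; rewrite /orient (edgeN ji); case: (edge i j) => //=.
      by move/edge_asym/negPf.
    + by apply: phiE.
  - move=> [j [k [A [B [[jh kh jk] [[AW BW mA mB] [b bP]]]]]]].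
    right; exists j, k, A, B; split; first by rewrite !inE jh kh !orbT.
    split; last by exists b.
    split=> //; [apply: subset_trans AW _|apply: subset_trans BW _];
      by apply/subsetP => x; rewrite inE => /andP[].
rewrite negb_exists => /forallP bad; right.
have mh : 0 < m * h by rewrite muln_gt0 m0; lia.
(* No [v] works, so the sets [A j] of vertices failing towards [j] cover [W i], and one of them has
   at least [m] elements. *)
pose A j := [set v in W i | M * #|N v j| < #|W j|].
have WA : W i \subset \bigcup_(j <- hs) A j.
  apply/subsetP => v vW; have := bad v; rewrite vW /= -has_predC.
  case/hasP=> j jh; rewrite /= -ltnNge => lt.
  by rewrite (big_rem j jh) /= inE; apply/orP; left; rewrite inE vW.
have [/hasP[j jh mA]|/hasPn small] := boolP (has (fun j => m <= #|A j|) hs).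
  exists i, j, (A j), (W j); split.
    by rewrite !inE eqxx jh orbT; split=> //; apply: contraNneq ih => ->.
  split; first split=> //.
  - by apply/subsetP => x; rewrite inE => /andP[].
  - apply: leq_trans (Wpow j _); last by rewrite inE jh orbT.
    by rewrite leq_pmulr; lia.
  - by exists (edge i j) => v; rewrite inE => /andP[_ /ltnW].
have : #|W i| <= size hs * m.
  apply: leq_trans (subset_leq_card WA) _.
  have -> : size hs * m = \sum_(j <- hs) m.
    by rewrite big_const_seq count_predT iter_addn_0 mulnC.
  have sm j : j \in hs -> #|A j| <= m by move=> /small; rewrite -ltnNge => /ltnW.
  elim: (hs) sm => [|j l IHl] sm; first by rewrite !big_nil cards0.
  rewrite !big_cons; apply: leq_trans (leq_card_setU _ _) _.
  rewrite leq_add ?sm ?inE ?eqxx //; apply: IHl => k kl.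
  by rewrite sm // inE kl orbT.
by move=> le; have := Wpow i (mem_head _ _); nia.
Qed.
End SparsePairs.

Lemma count_enum (T : finType) (A : {set T}) (p : pred T) :
  count p (enum A) = #|[set x in A | p x]|.
Proof.
rewrite -size_filter cardE; apply/perm_size/uniq_perm.
- exact/filter_uniq/enum_uniq.
- exact: enum_uniq.
- by move=> x; rewrite mem_filter !mem_enum inE andbC.
Qed.

(** Double counting: a heavy [y] is related to more than [size s / Q] entries of [s], and each entry
    to at most [#|A| / M] of the [y]. *)
Lemma few_heavy (T : finType) (A : {set T}) (s : seq T) (r : rel T) M Q :
  {in s, forall u, M * #|[set y in A | r y u]| <= #|A|} ->
  M * #|[set y in A | size s < Q * count (r y) s]| <= Q * #|A|.
Proof.
move=> few; set Bad := [set y in A | _].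
have [s0|s0] := posnP (size s).
  suff -> : Bad = set0 by rewrite cards0 muln0.
  by rewrite /Bad (size0nil s0); apply/setP => y; rewrite !inE muln0 andbF.
have dc : \sum_(y in A) count (r y) s = \sum_(u <- s) #|[set y in A | r y u]|.
  under eq_bigr do rewrite -sum1_count big_mkcond.
  rewrite exchange_big /=; apply: eq_bigr => u _.
  by rewrite -sum1dep_card [RHS]big_mkcondr.
rewrite -(leq_pmul2r s0).
have le1 : #|Bad| * size s <= \sum_(y in A) Q * count (r y) s.
  rewrite -sum_nat_const [leqRHS](bigID [in Bad]) /=.
  apply: leq_trans (leq_addr _ _); rewrite [leqRHS](eq_bigl [in Bad]) => [|y].
    by apply: leq_sum => y; rewrite inE => /andP[_ /ltnW].
  by rewrite inE; case: (y \in A).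
have le2 : M * \sum_(u <- s) #|[set y in A | r y u]| <= size s * #|A|.
  rewrite big_distrr /= mulnC.
  have -> : #|A| * size s = \sum_(u <- s) #|A|.
    by rewrite big_const_seq count_predT iter_addn_0 mulnC.
  by rewrite big_seq [leqRHS]big_seq; apply: leq_sum.
rewrite -mulnA; apply: leq_trans (_ : M * (Q * \sum_(y in A) count (r y) s) <= _).
  by rewrite leq_mul2l big_distrr /= le1 orbT.
by rewrite dc mulnCA -mulnA leq_mul2l [#|A| * _]mulnC le2 orbT.
Qed.

(** A sparse pair is sparse only as seen from [A]. Dropping the heavy vertices of [B] makes it
    sparse from both sides; as this may halve [B], the pair is first taken with [2 * M]. *)
Lemma smooth_pair (H : tournament) M : 0 < M ->
  exists2 D, 0 < D & forall T : tournament, ~ contains T H ->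
  forall V : {set T}, D <= #|V| ->
  exists A B : {set T}, [/\ A \subset V, B \subset V & [disjoint A & B]] /\
    [/\ #|V| <= D * #|A|, #|V| <= D * #|B|,
     {in A, forall x, M * #|[set y in B | edge y x]| <= #|B|} &
     {in B, forall y, M * #|[set x in A | edge y x]| <= #|A|}].
Proof.
(* Chosen so that [V] splits into [#|H|] parts of the size that the greedy embedding asks for, with
   [m] linear in [#|V|]. *)
move=> M0; pose h := #|H|.+1; pose d := h * h * (2 * M) ^ h.
have d0 : 0 < d by rewrite !muln_gt0 expn_gt0 muln_gt0 M0.
exists (4 * d); first by rewrite muln_gt0.
move=> T nTH V dV; pose m := #|V| %/ d.
have m0 : 0 < m by rewrite divn_gt0 //; lia.
have V2 : #|V| <= 2 * m * d by have := ltn_ceil #|V| d0; rewrite -/m; nia.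
have hE : size (enum H) = #|H| by rewrite cardE.
have qV : size (enum H) * (m * h * (2 * M) ^ h) <= #|V|.
  apply: leq_trans (leq_divM #|V| d); rewrite -/m hE /d.
  have : #|H| <= h by []; nia.
have [W [WV Wd]] := split_sets (enum_uniq H) qV.
have /card_gt0P[x0 _] : 0 < #|V| by lia.
have [||||||] := @embed_or_sparse T H (enum H) x0 W (2 * M) m h.
- exact: enum_uniq.
- by rewrite muln_gt0 M0.
- by [].
- by rewrite hE.
- move=> j /WV[_ ->]; rewrite leq_mul2l leq_pexp2l ?orbT ?muln_gt0 ?M0 //.
  by rewrite hE.
- case=> phi [_ phiE]; case: nTH; apply: (@contains_embed _ _ phi) => x y.
  by case: (eqVneq x y) => [->|]; rewrite ?edge_irr //; apply: phiE;
    rewrite mem_enum.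
case=> i [j [A [B [[ih jh ij] [[AW BW mA mB] [b few]]]]]].
have AV : A \subset V by apply: subset_trans AW (WV i ih).1.
have BV : B \subset V by apply: subset_trans BW (WV j jh).1.
have dAB : [disjoint A & B].
  by apply: disjointWl AW _; apply: disjointWr BW _; apply: Wd.
pose B' := [set y in B | M * #|[set x in A | orient b x y]| <= #|A|].
have B'B : B' \subset B by apply/subsetP => y; rewrite inE => /andP[].
have B'2 : #|B| <= 2 * #|B'|.
  have := @few_heavy _ B (enum A) (fun y x => orient b x y) (2 * M) M.
  rewrite -cardE; set Bad := [set y in B | _] => le.
  have {}le : 2 * #|Bad| <= #|B|.
    rewrite -(leq_pmul2l M0) mulnA [M * 2]mulnC; apply: le => x.
    by rewrite mem_enum; apply: few.
  suff : #|B| <= #|B'| + #|Bad| by move: le; clear; lia.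
  apply: leq_trans (leq_card_setU _ _); apply: subset_leq_card.
  by apply/subsetP => y yB; rewrite !inE yB count_enum /= leqNgt orNb.
have fewA : {in A, forall x, M * #|[set y in B' | orient b x y]| <= #|B'|}.
  move=> x xA; have := few x xA.
  have : #|[set y in B' | orient b x y]| <= #|[set y in B | orient b x y]|.
    apply: subset_leq_card; apply/subsetP => y; rewrite !inE.
    by case/andP => /andP[-> _].
  move=> le1 le2; rewrite -(leq_pmul2l (isT : 0 < 2)) mulnA.
  by apply: leq_trans B'2; apply: leq_trans le2; rewrite leq_mul2l le1 orbT.
have fewB : {in B', forall y, M * #|[set x in A | orient b x y]| <= #|A|}.
  by move=> y; rewrite inE => /andP[].
have dAB' : [disjoint A & B'] by apply: disjointWr B'B dAB.
have B'V := subset_trans B'B BV.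
have VA : #|V| <= 4 * d * #|A| by move: V2 mA; clear; nia.
have VB : #|V| <= 4 * d * #|B'| by move: V2 mB B'2; clear; nia.
(* The sparse direction [b] decides which of the two sets comes first. *)
by case: b {few B'2 B'B} @B' fewA fewB dAB' B'V VB => B' *;
  [exists B', A; rewrite disjoint_sym | exists A, B'].
Qed.

(* Backward, for [x] in the [i]-th and [y] in the [j]-th of disjoint parts. *)
Definition bwd (T : tournament) (i j : nat) (x y : T) := orient (j < i) x y.

Definition smooth (T : tournament) (V : {set T}) N D M (A : nat -> {set T}) :=
  [/\ forall i, i < N -> A i \subset V /\ #|V| <= D * #|A i|,
      forall i j, i < N -> j < N -> i != j -> [disjoint A i & A j] &
      forall i j, i < N -> j < N -> i != j ->
        {in A i, forall x, M * #|[set y in A j | bwd i j x y]| <= #|A j|}].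

(** Induction on [N]: one side of a smooth pair becomes the first part, the others are found in the
    other side. They may be [D] times smaller than that side, so the pair is taken with [M * D]. *)
Lemma smooth_family (H : tournament) M N : 0 < M ->
  exists2 D, 0 < D & forall T : tournament, ~ contains T H ->
  forall V : {set T}, D <= #|V| -> exists A, smooth V N D M A.
Proof.
move=> M0; elim: N => [|N [D D0 IH]]; first
  by exists 1 => // T _ V _; exists (fun _ => V).
have MD0 : 0 < M * D by rewrite muln_gt0 M0.
have [E E0 pair] := smooth_pair H MD0.
exists (E * D); first by rewrite muln_gt0 E0.
move=> T nTH V EDV.
have [|A0 [B [[AV BV dAB] [VA VB fewA fewB]]]] := pair T nTH V.
  by apply: leq_trans EDV; rewrite leq_pmulr.
have [|A [Asub Adis Afew]] := IH T nTH B.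
  by rewrite -(leq_pmul2l E0); apply: leq_trans EDV VB.
have dA i : i < N -> [disjoint A0 & A i].
  by move=> /Asub[? _]; apply: disjointWr dAB.
exists (fun i => if i is i'.+1 then A i' else A0); split.
- case=> [|i] iN.
    by split=> //; apply: leq_trans VA _; rewrite leq_mul2r leq_pmulr ?orbT.
  have [AB BA] := Asub i iN; split; first exact: subset_trans AB BV.
  by apply: leq_trans VB _; rewrite -mulnA leq_mul2l BA orbT.
- case=> [|i] [|j] //= iN jN ij; last exact: Adis.
    exact: dA.
  by rewrite disjoint_sym dA.
- case=> [|i] [|j] //= iN jN ij x xA.
  + have [AB BA] := Asub j jN.
    rewrite -(leq_pmul2l D0); apply: leq_trans BA; apply: leq_trans (fewA x xA).
    rewrite mulnA [D * M]mulnC leq_mul2l subset_leq_card ?orbT //.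
    by apply/subsetP => y; rewrite !inE => /andP[/(subsetP AB) yB e]; rewrite yB.
  + have [AB BA] := Asub i iN.
    apply: leq_trans (fewB x (subsetP AB x xA)); rewrite leq_mul2r leq_pmulr //.
    by rewrite orbT.
  + exact: (Afew i j iN jN ij x xA).
Qed.

(** * Minimal counterexamples *)

Definition fwd (T : tournament) (i j : nat) (x y : T) := orient (i < j) x y.

(* [t] is meant to be the largest size of a transitive set in [V]. *)
Definition critical (T : tournament) (V : {set T}) K t :=
  [/\ forall B : {set T}, B \subset V -> #|V| <= K * #|B| ->
        exists2 s, chain B s & K * t <= K * size s + t,
      forall s, chain V s -> size s <= t &
      K <= t].

Section Critical.
Variables (T : tournament) (V : {set T}) (A : nat -> {set T}).
Variables N D M K t q : nat.
Hypothesis critV : critical V K t.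
Hypothesis smoothA : smooth V N D M A.
Hypotheses (q_gt0 : 0 < q) (D_gt0 : 0 < D).
Hypotheses (M_large : 16 * q ^ 2 <= M) (K_large : 16 * q * D <= K).
Implicit Types (x y u v : T) (s z : seq T) (P : seq (nat * T)).

Lemma K_ge16q : 16 * q <= K.
Proof. by apply: leq_trans K_large; rewrite leq_pmulr. Qed.

Lemma t_gt0 : 0 < t.
Proof. by case: critV => _ _; have := K_ge16q; move: q_gt0; clear; lia. Qed.

Lemma subA i : i < N -> A i \subset V.
Proof. by case: smoothA => /(_ i) sA _ _ /sA[]. Qed.

Lemma fwdC i j x y : i != j -> fwd i j x y = fwd j i y x.
Proof. by rewrite /fwd /orient; case: ltngtP. Qed.

Lemma bwdE i j x y : i < N -> j < N -> i != j -> x \in A i -> y \in A j ->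
  bwd i j x y = ~~ fwd i j x y.
Proof.
case: smoothA => _ dA _ iN jN ij xA yA.
have xy : x != y.
  apply: contraTneq xA => ->; apply/negP => yAi.
  by have /pred0P/(_ y) := dA i j iN jN ij; rewrite /= yAi yA.
rewrite /fwd /bwd /orient; case: ltngtP ij => // _ _; rewrite edgeN //.
by rewrite eq_sym.
Qed.

Lemma few_back i j u : i < N -> j < N -> i != j -> u \in A j ->
  M * #|[set y in A i | ~~ fwd i j y u]| <= #|A i|.
Proof.
move=> iN jN ij uA; case: smoothA => _ _ few.
have := few j i jN iN; rewrite eq_sym => /(_ ij u uA); apply: leq_trans.
rewrite leq_mul2l subset_leq_card ?orbT //; apply/subsetP => y.
by rewrite !inE => /andP[yA]; rewrite yA (fwdC _ _ ij) bwdE // eq_sym.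
Qed.

(* A pair [(i, x)] in [P] records a vertex [x] already chosen in [A i]. *)
Definition placed P := all (fun p => (p.1 < N) && (p.2 \in A p.1)) P.

(** Vertices placed in the part [j] itself impose nothing; inside a part the direction comes from a
    chain. *)
Definition ok P j u := all (fun p => (p.1 != j) ==> fwd p.1 j p.2 u) P.

Definition rest P j := [set y in A j | ok P j y].

(** Union bound: each of at most [q] placed vertices excludes at most a fraction [1 / M] of
    [A j]. *)
Lemma rest_large P j : j < N -> placed P -> size P <= q ->
  4 * #|A j :\: rest P j| <= #|A j|.
Proof.
move=> jN plP Pq.
have le : M * #|A j :\: rest P j| <= size P * #|A j|.
  elim: P plP {Pq} => [_|p P IH /= /andP[/andP[pN pA] plP]].
    suff -> : A j :\: rest [::] j = set0 by rewrite cards0 muln0.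
    by apply/setP => y; rewrite !inE /= andbT andNb.
  pose F := [set y in A j | (p.1 != j) && ~~ fwd p.1 j p.2 y].
  have FM : M * #|F| <= #|A j|.
    rewrite /F; case: (eqVneq p.1 j) => [e|pj].
      suff -> : [set y in A j | false] = set0 by rewrite cards0 muln0.
      by apply/setP => y; rewrite !inE andbF.
    have := few_back jN pN; rewrite eq_sym => /(_ _ pj pA); apply: leq_trans.
    rewrite leq_mul2l subset_leq_card ?orbT //; apply/subsetP => y.
    by rewrite !inE fwdC.
  apply: leq_trans (_ : M * (#|F| + #|A j :\: rest P j|) <= _); last first.
    by rewrite mulnDr mulSn leq_add // IH.
  rewrite leq_mul2l; apply/orP; right; apply: leq_trans (leq_card_setU _ _).
  apply: subset_leq_card; apply/subsetP => y; rewrite !inE /=.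
  by case: (y \in A j) => //=; case: (p.1 == j) => //=; case: fwd.
rewrite -(leq_pmul2l q_gt0) mulnA.
apply: leq_trans (_ : size P * #|A j| <= _); last by rewrite leq_mul2r Pq orbT.
apply: leq_trans le; rewrite leq_mul2r; apply/orP; right.
by apply: leq_trans M_large; move: q_gt0; clear; nia.
Qed.

(** The threshold [t / K] is what a chain in a large set may lack to the maximum [t]. *)
Definition rich z := chain V z && (t < K * size z).

Lemma large_rich (B : {set T}) : B \subset V -> #|V| <= K * #|B| ->
  exists s, [/\ chain B s, rich s & K * t <= K * size s + t].
Proof.
case: (critV) => + _ _ => /(_ B) large BV /(large BV)[s cs ts]; exists s.
split=> //; rewrite /rich (chain_sub cs) /=; last first.
  by move=> x xs; apply: (subsetP BV); case/andP: cs => _ /allP; apply.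
move: ts t_gt0 K_ge16q q_gt0; clear; nia.
Qed.

Lemma rest_rich P j : j < N -> placed P -> size P <= q ->
  exists s, [/\ chain (rest P j) s, rich s & K * t <= K * size s + t].
Proof.
move=> jN plP Pq; have le := rest_large jN plP Pq; apply: large_rich.
  by apply: subset_trans (subA jN); apply/subsetP => y; rewrite inE => /andP[].
have VA : #|V| <= D * #|A j| by case: smoothA => /(_ j jN)[].
move: le; rewrite cardsD.
have : #|A j :&: rest P j| <= #|rest P j| by rewrite subset_leq_card // subsetIr.
move: (#|_ :&: _|) (#|rest P j|) (#|A j|) VA => a b d.
move: K_large q_gt0; clear => Kl q0 VA ab le.
have : d <= 2 * b by lia.
have : 16 * D <= K by nia.
nia.
Qed.

(** Otherwise a chain of almost [t] vertices in [F] and the chain [z] would concatenate, in the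
    order given by [b], to one longer than [t]. *)
Lemma rich_hit b z (F : {set T}) : rich z -> F \subset V -> #|V| <= K * #|F| ->
  exists2 y, y \in F & has (fun u => ~~ orient b y u) z.
Proof.
move=> /andP[cz tz] FV /(large_rich FV)[s [cs rs ts]].
suff /hasP[y ys hy] : has (fun y => has (fun u => ~~ orient b y u) z) s.
  by exists y => //; case/andP: cs => _ /allP; apply.
apply/negPn/negP; rewrite -all_predC => /allP miss.
have co : {in s & z, forall y u, orient b y u}.
  move=> y u /miss /=; rewrite -all_predC => /allP h /h /=; by rewrite negbK.
have cVs : chain V s by case/andP: rs.
case: (critV) => _ maxt _.
have : size s + size z <= t.
  case: (b) co => co.
    rewrite -size_cat; apply: maxt; rewrite chain_cat cVs cz /=.
    by apply/allrelP => y u ys uz; apply: co.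
  rewrite addnC -size_cat; apply: maxt; rewrite chain_cat cVs cz /=.
  by apply/allrelP => y u ys uz; apply: co.
move: ts tz; clear; nia.
Qed.

(* With [s] in [A j]: even after the restrictions imposed by [q] light
   vertices, each of [q] consecutive pieces of [s] keeps most of its elements. *)
Definition light s j b y := 4 * q ^ 2 * count (fun u => ~~ fwd b j y u) s <= size s.

Definition hit b y (p : nat * seq T) := has (fun u => ~~ fwd b p.1 y u) p.2.

(** Possible centers in part [b]: each has a backward edge into every chain of [zs] and conflicts
    with few entries of [s]. *)
Definition candidates b P s j zs :=
  [set y in rest P b | light s j b y && all (hit b y) zs].

(** The placed vertices exclude at most a quarter of [A b], lightness another quarter, and missing
    some chain of [zs] at most a sixteenth. *)
Lemma candidates_large b P s j zs :
  b < N -> placed P -> size P <= q -> j < N -> j != b -> {subset s <= A j} ->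
  size zs <= q -> all (fun p => rich p.2) zs ->
  #|V| <= K * #|candidates b P s j zs|.
Proof.
move=> bN plP Pq jN jb sA zq rz.
have VA : #|V| <= D * #|A b| by case: smoothA => /(_ b bN)[].
have le1 := rest_large bN plP Pq.
pose Bad := [set y in A b | ~~ light s j b y].
have le2 : 4 * #|Bad| <= #|A b|.
  have := @few_heavy _ (A b) s (fun y u => ~~ fwd b j y u) M (4 * q ^ 2).
  have -> : [set y in A b | size s < 4 * q ^ 2 * count (fun u => ~~ fwd b j y u) s]
      = Bad by apply/setP => y; rewrite !inE /light -ltnNge.
  have few : {in s, forall u, M * #|[set y in A b | ~~ fwd b j y u]| <= #|A b|}.
    by move=> u us; apply: few_back; rewrite 1?eq_sym // sA.
  move/(_ few) => le; rewrite -(@leq_pmul2l (4 * q ^ 2)); last first.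
    by rewrite muln_gt0 expn_gt0 q_gt0.
  apply: leq_trans le; rewrite mulnA leq_mul2r; apply/orP; right.
  by apply: leq_trans M_large; rewrite mulnC mulnA.
pose miss (p : nat * seq T) := [set y in A b | ~~ hit b y p].
(* A larger set of vertices missing a rich chain would contradict [rich_hit]. *)
have missK p : p \in zs -> K * #|miss p| <= #|V|.
  move/(allP rz) => rp; rewrite leqNgt; apply/negP => /ltnW lt.
  have [|y] := rich_hit (b < p.1) rp _ lt.
    by apply/subsetP => y; rewrite inE => /andP[/(subsetP (subA bN))].
  by rewrite inE => /andP[_ /negP].
pose U := \bigcup_(p <- zs) miss p.
have le3 : K * #|U| <= size zs * #|V|.
  rewrite /U; elim: (zs) missK => [|p l IH] mK.
    by rewrite big_nil cards0 muln0.
  rewrite big_cons /= mulSn.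
  apply: leq_trans (_ : K * (#|miss p| + #|\bigcup_(j <- l) miss j|) <= _).
    by rewrite leq_mul2l leq_card_setU orbT.
  rewrite mulnDr leq_add ?mK ?mem_head //; apply: IH => r rl.
  by rewrite mK // inE rl orbT.
have le4 : 16 * #|U| <= #|A b|.
  have qD : 0 < q * D by rewrite muln_gt0 q_gt0.
  rewrite -(leq_pmul2l qD) mulnA [q * D * 16]mulnC mulnA.
  apply: leq_trans (_ : K * #|U| <= _); first by rewrite leq_mul2r K_large orbT.
  apply: leq_trans le3 _; rewrite -mulnA; apply: leq_mul => //.
pose S := candidates b P s j zs.
have cover : #|A b| <= #|S| + (#|A b :\: rest P b| + (#|Bad| + #|U|)).
  apply: leq_trans (_ : #|S :|: ((A b :\: rest P b) :|: (Bad :|: U))| <= _).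
    apply: subset_leq_card; apply/subsetP => y yA.
    rewrite in_setU in_setU in_setU in_setD [y \in Bad]inE yA /=.
    case: (boolP (y \in U)) => [|yU]; rewrite ?orbT // orbF.
    rewrite in_set andbT; case: (y \in rest P b) => //=.
    case: (light s j b y) => //=; rewrite ?orbT // !orbF.
    apply/allP => p pz; apply: contraNT yU => hN.
    by rewrite /U (big_rem p pz) /= inE inE yA hN.
  apply: leq_trans (leq_card_setU _ _) _; rewrite leq_add2l.
  apply: leq_trans (leq_card_setU _ _) _; rewrite leq_add2l.
  exact: leq_card_setU.
have SA : #|A b| <= 4 * #|S|.
  by move: cover le1 le2 le4; clear; lia.
apply: leq_trans VA _; apply: leq_trans (_ : D * (4 * #|S|) <= _).
  by rewrite leq_mul2l SA orbT.
rewrite mulnA leq_mul2r; apply/orP; right; apply: leq_trans K_large.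
by move: q_gt0; clear; nia.
Qed.

Definition piece s i := take (size s %/ q) (drop (size s %/ q * i) s).

Lemma piece_edge s i j u v : chain V s -> i < j ->
  u \in piece s i -> v \in piece s j -> edge u v.
Proof.
rewrite /piece; set p := size s %/ q => cs ij up vp.
move: cs; rewrite -(cat_take_drop (p * j) s) chain_cat.
case/and3P=> _ _ /allrelP; apply; last exact: mem_take vp.
rewrite -(subnKC (_ : p * i <= p * j)) ?leq_mul2l ?(ltnW ij) ?orbT //.
rewrite takeD mem_cat; apply/orP; right.
have le : p <= p * j - p * i by rewrite -mulnBr leq_pmulr // subn_gt0.
by rewrite -(subnKC le) takeD mem_cat up.
Qed.

Lemma piece_sub s i : {subset piece s i <= s}.
Proof. by move=> u /mem_take /mem_drop. Qed.

(** A piece has about [size s / q] elements. The light vertices remove at most [size s / (4 * q)] of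
    them in all, and what remains exceeds [t / K]. *)
Lemma piece_rich s i j P :
  chain V s -> K * t <= K * size s + t -> i < q -> size P <= q ->
  all (fun p => (p.1 != j) ==> light s j p.1 p.2) P ->
  rich (filter (ok P j) (piece s i)).
Proof.
move=> cs ts iq Pq lP.
have cp : chain V (piece s i).
  have cd : chain V (drop (size s %/ q * i) s).
    move: cs; rewrite -{1}(cat_take_drop (size s %/ q * i) s) chain_cat.
    by case/and3P.
  move: cd; rewrite -{1}(cat_take_drop (size s %/ q) (drop _ _)) chain_cat.
  by case/and3P.
rewrite /rich chain_filter //=; set p := size s %/ q.
have sp : size (piece s i) = p.
  rewrite /piece size_take_min size_drop; apply/minn_idPl.
  rewrite -/p leq_subRL; last first.
    by apply: leq_trans (leq_divM (size s) q); rewrite leq_mul2l (ltnW iq) orbT.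
  rewrite addnC -mulnS; apply: leq_trans (leq_divM (size s) q).
  by rewrite leq_mul2l iq orbT.
have := ltn_ceil (size s) q_gt0; rewrite -/p => ceil.
pose c (p : nat * T) := count (fun u => (p.1 != j) && ~~ fwd p.1 j p.2 u) (piece s i).
have le1 : p <= size (filter (ok P j) (piece s i)) + \sum_(p <- P) c p.
  rewrite -sp size_filter -(count_predC (ok P j) (piece s i)) leq_add2l.
  elim: (P) => [|r l IH]; first by rewrite /= big_nil count_pred0.
  rewrite big_cons /c; apply: leq_trans (leq_add (leqnn _) IH).
  rewrite -count_predUI; apply: leq_trans (leq_addr _ _).
  by apply: sub_count => u /=; case: (r.1 == j); case: fwd.
have le2 : 4 * q ^ 2 * (\sum_(p <- P) c p) <= size P * size s.
  elim: (P) lP => [|r l IH] /=; first by rewrite big_nil muln0.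
  case/andP=> lr ll; rewrite big_cons mulnDr mulSn leq_add ?IH //.
  rewrite /c; case: (eqVneq r.1 j) lr => [_ _|_ /= lr].
    by rewrite count_pred0 muln0.
  apply: leq_trans lr; rewrite leq_mul2l; apply/orP; right.
  apply: leq_count_subseq; apply: subseq_trans (take_subseq _ _) _.
  exact: drop_subseq.
have {le2} le2 : 4 * q * (\sum_(p <- P) c p) <= size s.
  rewrite -(leq_pmul2l q_gt0); apply: leq_trans (_ : size P * size s <= _).
    by apply: leq_trans le2; rewrite -mulnn !mulnA [q * 4]mulnC.
  by rewrite leq_mul2r Pq orbT.
have Kt : K <= t by case: critV.
have := K_ge16q; have := t_gt0; move: le1 le2 ts ceil Kt q_gt0.
move: (size (filter _ _)) (\sum_(_ <- _) _) (size s) => f S sz; clear.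
move=> le1 le2 ts ceil Kt q0 t0 Kq.
have h1 : 3 * sz <= 4 * q * f + 4 * q by nia.
have h2 : 3 * (K * sz) <= 4 * q * (K * f) + 4 * q * K by nia.
(* Here [K <= t] absorbs the rounding in the division by [q]. *)
have h3 : 3 * (K * t) <= 4 * q * (K * f) + 4 * (q * t) + 3 * t by nia.
have h4 : 16 * (q * t) <= K * t by nia.
have h5 : t <= q * t by nia.
have : q * t * 4 < q * (K * f) * 4 by lia.
by rewrite ltn_mul2r /= ltn_mul2l => /andP[].
Qed.

End Critical.

(** * Embedding a galaxy *)

(* [rep] maps a vertex to the center of its star and fixes the isolated
   vertices; [ix x] is the index of the part in which [x] is to be placed. *)
Section GalaxyExtension.
Variables (T : tournament) (V : {set T}) (A : nat -> {set T}).
Variables N D M K t q : nat.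
Hypothesis critV : critical V K t.
Hypothesis smoothA : smooth V N D M A.
Hypotheses (q_gt0 : 0 < q) (D_gt0 : 0 < D).
Hypotheses (M_large : 16 * q ^ 2 <= M) (K_large : 16 * q * D <= K).

Variables (G : tournament) (rk ix : G -> nat) (rep : G -> G).
Hypotheses (rk_inj : injective rk) (rk_q : forall x, rk x < q).
Hypothesis ix_N : forall x, ix x < N.
Hypothesis rep_id : forall x, rep (rep x) = rep x.
Hypothesis backgraphE : forall x y, backgraph rk x y =
  [&& x != y, rep x == rep y & (x == rep x) || (y == rep y)].

(** The second condition excludes isolated vertices, which are placed in runs as leaves are. *)
Definition center c := (rep c == c) && [exists y, backgraph rk c y].

Hypothesis ix_mono : forall x y, ix x != ix y -> (ix x < ix y) = (rk x < rk y).
Hypothesis ix_center : forall c x, center c -> x != c -> ix x != ix c.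
Hypothesis ix_leaves : forall x y,
  ~~ center x -> ~~ center y -> rep x = rep y -> ix x = ix y.

Variables (P0 : seq (nat * T)) (x0 : T).
Hypothesis P0_placed : placed A N P0.
Hypothesis P0_size : size P0 + #|G| <= q.

Implicit Types (phi : G -> T) (Dn : {set G}) (x y c : G) (s : seq T).

(** [P0] holds the vertices chosen before the galaxy; in the application these are the images of the
    vertices of [Hl]. *)
Definition places Dn phi := P0 ++ [seq (ix x, phi x) | x <- enum Dn].

Definition partial_copy Dn phi :=
  [/\ {in Dn, forall x, phi x \in A (ix x)},
      {in Dn, forall x, ok P0 (ix x) (phi x)} &
      {in Dn &, forall x y, x != y ->
         orient (rk x < rk y) (phi x) (phi y) = ~~ backgraph rk x y}].

Lemma places_size Dn phi : size (places Dn phi) <= q.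
Proof.
apply: leq_trans P0_size; rewrite size_cat leq_add2l size_map -cardE.
exact: max_card.
Qed.

Lemma places_placed Dn phi : partial_copy Dn phi -> placed A N (places Dn phi).
Proof.
case=> pA _ _; rewrite /placed all_cat; apply/andP; split=> //.
by apply/allP => _ /mapP[x + ->] /=; rewrite mem_enum ix_N => /pA ->.
Qed.

Lemma orientC x y (u v : T) : x != y ->
  orient (rk x < rk y) u v = orient (rk y < rk x) v u.
Proof. by rewrite -(inj_eq rk_inj) /orient; case: ltngtP. Qed.

Lemma fwd_rk x y (u v : T) : ix x != ix y ->
  fwd (ix x) (ix y) u v = orient (rk x < rk y) u v.
Proof. by move=> /ix_mono; rewrite /fwd => ->. Qed.

Lemma leaf_not_center x : rep x != x -> ~~ center x.
Proof. by rewrite /center => /negPf ->. Qed.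

Lemma rep_center x : rep x != x -> center (rep x).
Proof.
move=> rx; rewrite /center rep_id eqxx /=; apply/existsP; exists x.
by rewrite backgraphE rx rep_id !eqxx.
Qed.

Section Run.
Variables (s : seq T) (k : nat).
Hypotheses (k_N : k < N) (s_chain : chain V s).
Hypothesis s_large : K * t <= K * size s + t.
Hypotheses (sA : {subset s <= A k}) (s_ok : {in s, forall u, ok P0 k u}).

(** Invariant while part [k] is being filled: vertices outside this part stay light, so that every
    piece of [s] remains rich after their conflicts are removed. *)
Definition run_copy Dn phi := partial_copy Dn phi /\
  {in Dn, forall x, if ix x == k then phi x \in piece q s (rk x)
                    else light q s k (ix x) (phi x)}.

(* Pieces are indexed by rank, so that the transitive order of [s] agrees with
   the ordering of [G] inside a run. *)
Definition room Dn phi x := filter (ok (places Dn phi) k) (piece q s (rk x)).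

Lemma light_ok P p : {in s, forall u, ok P k u} -> p \in P -> p.1 != k ->
  light q s k p.1 p.2.
Proof.
move=> sP pP pk; rewrite /light.
suff -> : count (fun u => ~~ fwd p.1 k p.2 u) s = 0 by rewrite muln0.
apply/eqP; rewrite -leqn0 leqNgt -has_count -all_predC; apply/allP => u us.
by have /allP/(_ p pP) := sP u us; rewrite pk /= negbK.
Qed.

Lemma room_rich Dn phi x : run_copy Dn phi -> rich V K t (room Dn phi x).
Proof.
case=> pc rc; apply: (piece_rich critV q_gt0 D_gt0 K_large) => //.
  exact: places_size.
rewrite all_cat; apply/andP; split.
  by apply/allP => p pP; apply/implyP; apply: light_ok s_ok pP.
apply/allP => _ /mapP[y + ->] /=; rewrite mem_enum => /rc.
by case: (ix y == k).
Qed.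

Lemma room_mem Dn phi x u : u \in room Dn phi x ->
  [/\ u \in piece q s (rk x), u \in A k, ok P0 k u &
      {in Dn, forall y, ix y != k -> fwd (ix y) k (phi y) u}].
Proof.
rewrite mem_filter /ok all_cat => /andP[/andP[h1 h2] up].
split=> //; first exact/sA/(piece_sub up).
move=> y yD yk; move/allP: h2 => /(_ (ix y, phi y)) /=.
by rewrite yk; apply; apply: map_f; rewrite mem_enum.
Qed.

Lemma room_edge Dn phi x y u : run_copy Dn phi -> u \in room Dn phi x ->
  ix x = k -> y \in Dn -> y != x -> orient (rk y < rk x) (phi y) u.
Proof.
move=> [_ rc] /room_mem[up uA _ uf] xk yD yx.
have := rc y yD; case: eqP => [yk yp|/eqP yk _]; last first.
  by have := uf y yD yk; rewrite -xk fwd_rk // xk.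
have: rk y != rk x by rewrite (inj_eq rk_inj).
by rewrite /orient; case: ltngtP => // lt _; apply: (piece_edge (q := q) s_chain lt).
Qed.

(** Gluing of one star, or one isolated vertex, [L] to the part already embedded. *)
Lemma extend_copy Dn phi (L : {set G}) (g : G -> T) :
  run_copy Dn phi -> [disjoint Dn & L] ->
  {in Dn & L, forall x y, ~~ backgraph rk x y} ->
  {in L, forall x, g x \in A (ix x)} ->
  {in L, forall x, ok P0 (ix x) (g x)} ->
  {in L, forall x, if ix x == k then g x \in piece q s (rk x)
                   else light q s k (ix x) (g x)} ->
  {in Dn & L, forall x y, orient (rk x < rk y) (phi x) (g y)} ->
  {in L &, forall x y, x != y ->
     orient (rk x < rk y) (g x) (g y) = ~~ backgraph rk x y} ->
  exists psi, run_copy (Dn :|: L) psi.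
Proof.
move=> [[pA pP pE] rc] dL nB gA gP gr gD gE.
have nL x : x \in Dn -> (x \in L) = false.
  by move=> xD; apply: (disjointFr dL).
exists (fun x => if x \in L then g x else phi x); split; first split.
- by move=> x; rewrite inE; case: ifP => [xL _|_]; [apply: gA|rewrite orbF => /pA].
- by move=> x; rewrite inE; case: ifP => [xL _|_]; [apply: gP|rewrite orbF => /pP].
- move=> x y; rewrite !inE.
  case: ifP => [xL _|_]; last first.
    rewrite orbF => xD; case: ifP => [yL _|_]; first by rewrite gD // nB.
    by rewrite orbF; apply: pE.
  case: ifP => [yL _|_]; first exact: gE.
  rewrite orbF => yD xy; rewrite orientC // gD //.
  by apply/esym; have := nB y x yD xL; rewrite /backgraph orbC.
- move=> x; rewrite inE; case: (boolP (x \in L)) => [xL _|_]; first exact: gr.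
  by rewrite orbF => /rc.
Qed.

(** The center is chosen first, with a backward edge into the room of each leaf; each leaf is then a
    backward neighbour of it in its own room. An isolated vertex takes any element of its room. *)
Lemma star_step Dn phi c : run_copy Dn phi -> rep c = c ->
  (forall x, rep x = c -> x \notin Dn) ->
  (forall x, rep x = c -> ~~ center x -> ix x = k) ->
  exists psi, run_copy (Dn :|: [set x | rep x == c]) psi.
Proof.
move=> rcD rc nD ck; have [pc rcp] := rcD.
set L := [set x | _].
have dL : [disjoint Dn & L].
  rewrite disjoint_sym; apply/pred0P => x /=; rewrite inE.
  by apply/negP => /andP[/eqP/nD/negP].
have nB : {in Dn & L, forall x y, ~~ backgraph rk x y}.
  move=> x y xD; rewrite inE backgraphE => /eqP ->.
  apply/negP => /and3P[_ /eqP /nD]; by rewrite xD.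
have [cc|ncc] := boolP (center c); last first.
  have LE : L = [set c].
    apply/setP => x; rewrite !inE; apply/eqP/eqP => [e|->//].
    by apply/eqP; apply: contraNT ncc => xc; rewrite -e rep_center // e eq_sym.
  have ick := ck c rc ncc.
  have : rich V K t (room Dn phi c) by apply: room_rich.
  case E : (room Dn phi c) => [|u z]; first by rewrite /rich /= muln0.
  move=> _; have uR : u \in room Dn phi c by rewrite E mem_head.
  have [up uA uP _] := room_mem uR.
  apply: (extend_copy (g := fun _ => u) rcD) => //.
  + by move=> x; rewrite LE inE => /eqP ->; rewrite ick.
  + by move=> x; rewrite LE inE => /eqP ->; rewrite ick.
  + by move=> x; rewrite LE inE => /eqP ->; rewrite ick eqxx.
  + move=> x y xD; rewrite LE inE => /eqP ->; apply: (room_edge rcD uR ick xD).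
    by apply: contraTneq xD => ->; apply: nD.
  + by move=> x y; rewrite LE !inE => /eqP -> /eqP ->; rewrite eqxx.
pose L' := [set x in L | x != c].
have L'k x : x \in L' -> ix x = k.
  by rewrite !inE => /andP[/eqP e xc]; apply: ck => //; rewrite leaf_not_center // e eq_sym.
have ick : ix c != k.
  have /andP[_ /existsP[y]] := cc; rewrite backgraphE rc => /and3P[cy /eqP ry _].
  rewrite eq_sym -(L'k y) ?ix_center //; first by rewrite eq_sym.
  by rewrite !inE -ry eqxx eq_sym.
pose zs := [seq (k, room Dn phi x) | x <- enum L'].
have : #|V| <= K * #|candidates A q (ix c) (places Dn phi) s k zs|.
  apply: (candidates_large critV smoothA q_gt0 D_gt0 M_large K_large) => //.
  - exact: places_placed.
  - exact: places_size.
  - by rewrite eq_sym.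
  - rewrite size_map -cardE; apply: leq_trans (max_card _) _.
    by apply: leq_trans P0_size; rewrite leq_addl.
  - by apply/allP => _ /mapP[x _ ->]; apply: room_rich.
have V0 : 0 < #|V|.
  have [u us] : exists u, u \in s.
    case E : s => [|u z]; last by exists u; rewrite mem_head.
    move: s_large; rewrite E muln0 add0n.
    have := t_gt0 critV q_gt0 D_gt0 K_large.
    have := K_ge16q D_gt0 K_large; move: q_gt0; clear; nia.
  by apply/card_gt0P; exists u; case/andP: s_chain => _ /allP; apply.
move/(leq_trans V0); rewrite muln_gt0 => /andP[_ /card_gt0P[y]].
rewrite 2!inE => /and3P[/andP[yA]]; rewrite /ok all_cat => /andP[yP yD] yl.
move=> /allP yh.
pose good x := filter (fun u => ~~ fwd (ix c) k y u) (room Dn phi x).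
(* The default [x0] is not reached on leaves, since the center hits each of their rooms. *)
pose g x := if x == c then y else head x0 (good x).
have gL x : x \in L' -> g x \in good x.
  move=> xL; have := yh (k, room Dn phi x).
  rewrite /g; have /negPf -> : x != c by move: xL; rewrite !inE => /andP[].
  rewrite map_f ?mem_enum // => /(_ isT); rewrite /hit has_filter /= -/(good x).
  by case: (good x) => //= u z _; rewrite mem_head.
have gR x : x \in L' -> g x \in room Dn phi x.
  by move/gL; rewrite mem_filter => /andP[].
have gc : g c = y by rewrite /g eqxx.
have LP x : x \in L -> x = c \/ x \in L'.
  by move=> xL; case: (eqVneq x c) => [|xc]; [left|right; rewrite inE xL].
have gE x : x \in L' -> orient (rk c < rk x) y (g x) = ~~ backgraph rk c x.
  move=> xL; have cx : ix c != ix x by rewrite (L'k x xL).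
  have := gL x xL; rewrite mem_filter => /andP[+ _].
  rewrite -{1}(L'k x xL) fwd_rk // => /negPf ->.
  apply/esym/negbF; rewrite backgraphE rc eqxx /= andbT.
  by move: xL; rewrite !inE => /andP[/eqP -> xc]; rewrite eq_sym xc eqxx.
apply: (extend_copy (g := g) rcD) => //.
- move=> x /LP[->|xL]; first by rewrite gc.
  by rewrite L'k //; have [] := room_mem (gR x xL).
- move=> x /LP[->|xL]; first by rewrite gc.
  by rewrite L'k //; have [] := room_mem (gR x xL).
- move=> x /LP[->|xL]; first by rewrite gc (negPf ick).
  by rewrite L'k // eqxx; have [] := room_mem (gR x xL).
- move=> x z xD /LP[->|zL]; last first.
    apply: (room_edge rcD (gR z zL) (L'k z zL) xD).
    by apply: contraTneq xD => ->; apply: nD; move: zL; rewrite !inE => /andP[/eqP].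
  have xc : x != c by apply: contraTneq xD => ->; apply: nD.
  rewrite gc -fwd_rk ?ix_center //; move/allP: yD => /(_ (ix x, phi x)).
  by rewrite map_f ?mem_enum //= ix_center //; apply.
- move=> x z /LP[->|xL] /LP[->|zL].
  + by rewrite eqxx.
  + by move=> _; rewrite gc gE.
  + move=> xc; rewrite orientC // gc gE //.
    by rewrite /backgraph orbC.
  + move=> xz; have -> : backgraph rk x z = false.
      rewrite backgraphE; move: xL zL; rewrite !inE.
      move=> /andP[/eqP -> /negPf ->] /andP[/eqP -> /negPf ->].
      by rewrite !andbF.
    have [xp _ _ _] := room_mem (gR x xL).
    have [zp _ _ _] := room_mem (gR z zL).
    have: rk x != rk z by rewrite (inj_eq rk_inj).
    by rewrite /orient; case: ltngtP => // lt _; apply: (piece_edge (q := q) s_chain lt).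
Qed.

End Run.

(* The part containing the leaves of the star of [x]. *)
Definition run x :=
  if [pick y | (rep y == rep x) && ~~ center y] is Some y then ix y else 0.

Lemma run_ix x : ~~ center x -> run x = ix x.
Proof.
rewrite /run => ncx; case: pickP => [y /andP[/eqP e ncy]|/(_ x)].
  exact: ix_leaves.
by rewrite eqxx ncx.
Qed.

Lemma run_rep x y : rep x = rep y -> run x = run y.
Proof. by rewrite /run => ->. Qed.

(** A single chain [s] in part [k], compatible with everything placed so far, serves all stars with
    leaves in that part and all isolated vertices assigned to it. *)
Lemma run_step Dn phi k : partial_copy Dn phi -> k < N ->
  Dn = [set x | run x < k] ->
  exists psi, partial_copy [set x | run x < k.+1] psi.
Proof.
move=> pc kN DnE.
have [/existsP[w /andP[ncw /eqP wk]]|none] :=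
    boolP [exists w, ~~ center w && (run w == k)]; last first.
  exists phi; rewrite (_ : [set x | run x < k.+1] = Dn) // DnE.
  apply/setP => x; rewrite !inE ltnS leq_eqVlt; case: eqP => //= xk.
  case/negP: none; apply/existsP; have [cx|ncx] := boolP (center x); last first.
    by exists x; rewrite ncx xk eqxx.
  have /andP[/eqP rx /existsP[y]] := cx; rewrite backgraphE.
  case/and3P=> xy /eqP ry _; exists y; rewrite -(run_rep ry) xk eqxx andbT.
  by apply: leaf_not_center; rewrite -ry rx.
have ncix c : center c -> ix c != k.
  move=> cc; rewrite -wk run_ix // eq_sym ix_center //.
  by apply: contraNneq ncw => ->.
have plp := places_placed pc.
have [s [cR rs ts]] :=
  rest_rich critV smoothA q_gt0 D_gt0 M_large K_large kN plp (places_size _ _).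
have sR u : u \in s -> u \in rest A (places Dn phi) k.
  by case/andP: cR => _ /allP; apply.
have cs : chain V s by case/andP: rs.
have sA : {subset s <= A k} by move=> u /sR; rewrite inE => /andP[].
have sok : {in s, forall u, ok (places Dn phi) k u}.
  by move=> u /sR; rewrite inE => /andP[].
have sP0 : {in s, forall u, ok P0 k u}.
  by move=> u /sok; rewrite /ok all_cat => /andP[].
(* Earlier vertices have no conflict with [s], hence are light, and none of them lies in part
   [k]. *)
have start : run_copy s k Dn phi.
  split=> // x xD; case: eqP => [xk|/eqP xk]; last first.
    apply: (light_ok (p := (ix x, phi x)) sok) => //.
    by rewrite mem_cat map_f ?orbT // mem_enum.
  exfalso; move: xD; rewrite DnE inE; have [/ncix|/run_ix ->] := boolP (center x).
    by rewrite xk eqxx.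
  by rewrite xk ltnn.
(* The stars of the run are added one at a time, through their representatives. *)
suff loop l : uniq l -> exists psi,
    run_copy s k (Dn :|: [set x | (run x == k) && (rep x \in l)]) psi.
  have [psi [pcp _]] := loop (enum G) (enum_uniq _); exists psi.
  rewrite (_ : [set x | run x < k.+1] =
             Dn :|: [set x | (run x == k) && (rep x \in enum G)]) //.
  apply/setP => x; rewrite DnE !inE mem_enum ltnS leq_eqVlt orbC.
  by case: eqP => _; rewrite ?andbT.
elim: l => [_|c l IH /= /andP[cl ul]].
  exists phi; rewrite (_ : [set x | _] = set0) ?setU0 //.
  by apply/setP => x; rewrite !inE andbF.
have [psi rpsi] := IH ul.
have [/andP[/eqP rc /eqP ck]|nc] := boolP ((rep c == c) && (run c == k)); last first.
  exists psi; rewrite (_ : [set x | _ & _ \in c :: l] =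
                           [set x | (run x == k) && (rep x \in l)]) //.
  apply/setP => x; rewrite !inE; case: eqP => //= xk.
  case: eqP => //= xc; case/negP: nc.
  by rewrite -xc rep_id eqxx -xk; apply/eqP/run_rep/rep_id.
have xrun x : rep x = c -> run x = k.
  by move=> xc; rewrite -ck; apply: run_rep; rewrite xc rc.
have [||chi rchi] := star_step kN cs ts sA sP0 rpsi rc.
- move=> x xc; rewrite DnE !inE xrun // ltnn eqxx xc /=; exact: cl.
- by move=> x xc ncx; rewrite -(run_ix ncx) xrun.
exists chi; move: rchi; rewrite -setUA.
rewrite (_ : _ :|: [set x | rep x == c] =
             [set x | (run x == k) && (rep x \in c :: l)]) //.
apply/setP => x; rewrite !inE.
case: (eqVneq (rep x) c) => [e|_]; last by rewrite orbF.
by rewrite (xrun x e) eqxx !orbT.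
Qed.

Lemma galaxy_extension :
  exists phi : G -> T, [/\ forall x, phi x \in A (ix x),
    forall x, ok P0 (ix x) (phi x) & {mono phi : x y / edge x y}].
Proof.
suff /(_ N) [//|phi [pA pP pE]] : forall k, k <= N ->
    exists phi, partial_copy [set x | run x < k] phi.
  have run_N x : x \in [set x | run x < N].
    rewrite inE /run; case: pickP => [y _|_]; first exact: ix_N.
    by apply: leq_ltn_trans (ix_N x).
  exists phi; split=> [x|x|x y]; [exact: pA|exact: pP|].
  have [->|xy] := eqVneq x y; first by rewrite !edge_irr.
  have := pE x y (run_N x) (run_N y) xy.
  have nrk : rk x != rk y by rewrite (inj_eq rk_inj).
  have [Bxy|nB] := boolP (backgraph rk x y); last first.
    move: nB; rewrite /backgraph /backward /orient.
    case: ltngtP nrk => //= _ _; rewrite ?andbT ?andbF ?orbF /=.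
      by move=> /negPf -> /edge_asym/negPf.
    by move=> nyx ->; rewrite (edgeN xy) nyx.
  have ixy : ix x != ix y.
    move: (Bxy); rewrite backgraphE => /and3P[_ /eqP rxy] /orP[] /eqP r.
      rewrite eq_sym ix_center //; last by rewrite eq_sym.
      by rewrite /center -r eqxx; apply/existsP; exists y.
    rewrite ix_center // /center -r eqxx; apply/existsP; exists x.
    by move: Bxy; rewrite /backgraph orbC.
  (* The copy only says that the pair is not forward; as the parts are disjoint, its ends are
     distinct and the edge is backward. *)
  rewrite -fwd_rk // => /negbT; rewrite -(bwdE smoothA) ?pA //.
  rewrite /bwd ix_mono 1?eq_sym //.
  move: Bxy; rewrite /backgraph /backward /orient.
  case: ltngtP nrk => //= _ _; rewrite ?andbT ?andbF ?orbF /=.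
    by move=> -> ->.
  by move=> /edge_asym/negPf -> /edge_asym/negPf.
elim=> [_|k IH kN].
  by exists (fun _ => x0); split=> x; rewrite inE.
have [phi pc] := IH (ltnW kN); exact: (run_step pc kN (erefl _)).
Qed.

End GalaxyExtension.

(** * Assigning parts to the vertices of a galaxy *)

Section GalaxyBlocks.
Variables (G : tournament) (theta : seq G) (C : {set G}) (s : nat).
Hypothesis G_galaxy : galaxy_ordering theta C.
Hypothesis no_straddle : forall K, K \in stars (position theta) ->
  forall x y, x \in K :\: C -> y \in K :\: C ->
    ~ (position theta x <= s < position theta y).

Let pos := position theta.
Let B := backgraph pos.
Let comp x := [set y | connect B x y].

Implicit Types x y c : G.

Lemma pos_inj : injective pos.
Proof.
case: G_galaxy => [[_ allx] _] x y [] e.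
by rewrite -(nth_index x (allx x)) e nth_index.
Qed.

Lemma pos_le x : pos x <= #|G|.
Proof.
have [[uth allx] _] := G_galaxy.
have <- : size theta = #|G|.
  by rewrite cardE; apply/perm_size/uniq_perm; rewrite ?enum_uniq // => z;
    rewrite mem_enum allx.
by rewrite index_mem.
Qed.

Lemma B_sym : symmetric B.
Proof. by move=> x y; rewrite /B /backgraph orbC. Qed.

Lemma B_neq x y : B x y -> x != y.
Proof.
by apply: contraTneq => ->; rewrite /B /backgraph /backward edge_irr.
Qed.

Lemma comp_refl x : x \in comp x.
Proof. by rewrite inE connect0. Qed.

Lemma comp_eq x y : y \in comp x -> comp y = comp x.
Proof.
rewrite inE => xy; apply/setP => z; rewrite !inE.
by rewrite (same_connect (sym_connect_sym B_sym) xy).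
Qed.

Lemma comp_in x : comp x \in components pos.
Proof. exact: imset_f. Qed.

Lemma comp_star x : [exists y, B x y] ->
  comp x \in stars pos /\ exists2 c, comp x :&: C = [set c] &
    left_star pos (comp x) c \/ right_star pos (comp x) c.
Proof.
case/existsP=> y Bxy.
have c1 : 1 < #|comp x|.
  apply: leq_trans (_ : #|[set x; y]| <= _); first by rewrite cards2 B_neq.
  apply: subset_leq_card; apply/subsetP => z; rewrite !inE.
  by case/orP=> /eqP ->; rewrite ?connect0 ?connect1.
split; first by rewrite inE comp_in.
have [_ [/(_ _ (comp_in x)) + _]] := G_galaxy.
by case=> // e; rewrite e in c1.
Qed.

(** The default of [odflt] is not reached: a component with an edge meets [C] in exactly one
    vertex. *)
Definition star_rep x :=
  if [exists y, B x y] then odflt x [pick c in comp x :&: C] else x.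

Lemma star_repP x : [exists y, B x y] ->
  [/\ comp x \in stars pos, comp x :&: C = [set star_rep x],
      {in comp x &, forall u v,
         B u v = (u != v) && ((u == star_rep x) || (v == star_rep x))} &
      {in comp x, forall v, v != star_rep x -> pos (star_rep x) < pos v} \/
      {in comp x, forall v, v != star_rep x -> pos v < pos (star_rep x)}].
Proof.
move=> ex; have [st [c cE lr]] := comp_star ex.
have -> : star_rep x = c.
  rewrite /star_rep ex; case: pickP => [d|/(_ c)]; rewrite cE inE.
    by move/eqP.
  by rewrite eqxx.
by split=> //; [case: lr => [[[]]|[[]]]|case: lr => [[_]|[_]]; [left|right]].
Qed.

Lemma star_rep_isolated x : ~~ [exists y, B x y] -> star_rep x = x.
Proof. by rewrite /star_rep => /negPf ->. Qed.

Lemma star_rep_comp x : star_rep x \in comp x.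
Proof.
have [/star_repP[_ E _ _]|/star_rep_isolated ->] := boolP [exists y, B x y].
  by have := set11 (star_rep x); rewrite -E inE => /andP[].
exact: comp_refl.
Qed.

Lemma star_rep_eq x y : [exists z, B x z] -> [exists z, B y z] ->
  comp x = comp y -> star_rep x = star_rep y.
Proof.
move=> /star_repP[_ Ex _ _] /star_repP[_ Ey _ _] e.
by apply/set1P; rewrite -Ey -e Ex set11.
Qed.

Lemma star_backgraphE x y : backgraph pos x y =
  [&& x != y, star_rep x == star_rep y & (x == star_rep x) || (y == star_rep y)].
Proof.
rewrite -/(B x y); apply/idP/and3P => [Bxy|[xy /eqP rxy r]].
  have ex : [exists z, B x z] by apply/existsP; exists y.
  have ey : [exists z, B y z] by apply/existsP; exists x; rewrite B_sym.
  have yx : y \in comp x by rewrite inE connect1.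
  have rxy := star_rep_eq ex ey (esym (comp_eq yx)).
  have [_ _ E _] := star_repP ex.
  have := Bxy; rewrite (E x y (comp_refl x) yx) => /andP[-> H].
  by split=> //; rewrite -rxy.
have cxy : comp x = comp y.
  by rewrite -(comp_eq (star_rep_comp x)) -(comp_eq (star_rep_comp y)) rxy.
have nonisolated : [exists z, B x z] -> B x y.
  move=> ex; have [_ _ E _] := star_repP ex; rewrite E ?comp_refl //.
    by rewrite xy; move: r; rewrite -rxy.
  by rewrite cxy comp_refl.
have [//|/[dup] nx /star_rep_isolated rx] := boolP [exists z, B x z].
have ey : [exists z, B y z].
  by apply: contraT => /star_rep_isolated ry; rewrite -rx -ry rxy eqxx in xy.
have [_ _ E _] := star_repP ey; rewrite E ?comp_refl -?cxy ?comp_refl //.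
by rewrite xy -rxy rx eqxx.
Qed.

Lemma star_rep_id x : star_rep (star_rep x) = star_rep x.
Proof.
have [e|xr] := eqVneq (star_rep x) x; first by rewrite !e.
have [ex|/star_rep_isolated rx] := boolP [exists y, B x y]; last first.
  by rewrite rx eqxx in xr.
have [_ _ E _] := star_repP ex.
have : B x (star_rep x).
  by rewrite E ?comp_refl ?star_rep_comp // eq_sym xr eqxx orbT.
by rewrite /B star_backgraphE => /and3P[_ /eqP <-].
Qed.

Local Notation ctr := (center pos star_rep).

(* [7 + s] is the rank of [h_7] in the product. *)
Definition breakpoint b :=
  (b == 7 + s) || [exists c, ctr c && (rho2 theta s c == b)].

(** All breakpoints are positive, so the value 0 means that there is none below [n]. *)
Definition last_break n := \max_(b < n | breakpoint b) b.

(* Even blocks hold a single center, odd blocks a run of noncenters; block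
   [(7 + s).*2] is left free for [h_7]. *)
Definition block x :=
  if ctr x then (rho2 theta s x).*2 else (last_break (rho2 theta s x)).*2.+1.

Lemma rho2_lt x y : (rho2 theta s x < rho2 theta s y) = (pos x < pos y).
Proof.
rewrite /rho2 -/pos; move: (pos x) (pos y) => p r.
by case: (leqP p s); case: (leqP r s); lia.
Qed.

Lemma rho2_split x : (rho2 theta s x < 7 + s) = (pos x <= s).
Proof. by rewrite /rho2 -/pos; move: (pos x) => p; case: (leqP p s); lia. Qed.

Lemma rho2_neq x : rho2 theta s x != 7 + s.
Proof. by rewrite /rho2 -/pos; move: (pos x) => p; case: (leqP p s); lia. Qed.

Lemma rho2_pos x : 0 < rho2 theta s x.
Proof. by rewrite /rho2; case: ifP. Qed.

Lemma last_break_lt n : 0 < n -> last_break n < n.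
Proof.
by case: n => // n _; rewrite ltnS; apply/bigmax_leqP => b _; rewrite -ltnS.
Qed.

Lemma last_break_ge n b : b < n -> breakpoint b -> b <= last_break n.
Proof. by move=> bn bb; apply: (leq_bigmax_cond (Ordinal bn)). Qed.

Lemma last_break_mono n m : n <= m -> last_break n <= last_break m.
Proof.
move=> nm; apply/bigmax_leqP => b bb.
by apply: last_break_ge => //; apply: leq_trans nm.
Qed.

Lemma block_bound x : block x < (8 + #|G|).*2.
Proof.
have : rho2 theta s x <= 7 + #|G|.
  by have := pos_le x; rewrite /rho2 -/pos; case: ifP => _; lia.
by have := last_break_lt (rho2_pos x); rewrite /block; case: ifP => _; lia.
Qed.

Lemma block_mono x y : pos x < pos y -> block x <= block y.
Proof.
rewrite -rho2_lt => lt; have := last_break_lt (rho2_pos x).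
have := last_break_mono (ltnW lt); rewrite /block.
have [cx|_] := boolP (ctr x); last by case: ifP => _; lia.
have : rho2 theta s x <= last_break (rho2 theta s y).
  apply: last_break_ge => //; apply/orP; right.
  by apply/existsP; exists x; rewrite cx eqxx.
by case: ifP => _; lia.
Qed.

Lemma block_ltE x y : block x != block y -> (block x < block y) = (pos x < pos y).
Proof.
move=> bxy; case: (ltngtP (pos x) (pos y)) => [/block_mono|/block_mono|/pos_inj e].
- by rewrite leq_eqVlt (negPf bxy).
- by rewrite leqNgt => /negPf.
- by rewrite e ltnn.
Qed.

Lemma block_center c x : ctr c -> x != c -> block x != block c.
Proof.
move=> cc xc; rewrite /block cc; case: ifP => _; last first.
  by apply/eqP => e; have := congr1 odd e; rewrite /= !odd_double.
apply: contraNneq xc => /double_inj e; apply/eqP/pos_inj.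
by move: (rho2_lt x c) (rho2_lt c x); rewrite e ltnn; case: ltngtP.
Qed.

(** No breakpoint separates two leaves of a star: [7 + s] does not by [no_straddle], the center of
    another star by the galaxy condition, and their own center lies on one side of all of them. *)
Lemma block_leaves x y : ~~ ctr x -> ~~ ctr y -> star_rep x = star_rep y ->
  block x = block y.
Proof.
wlog : x y / pos x < pos y => [wl ncx ncy rxy|lt ncx ncy rxy].
  case: (ltngtP (pos x) (pos y)) => [lt|lt|/pos_inj -> //]; first exact: wl.
  by apply/esym/wl.
have noniso z : ~~ ctr z -> z != star_rep z -> [exists w, B z w].
  move=> _ zr; apply: contraNT zr => /star_rep_isolated -> //.
have xy : x != y by apply: contraTneq lt => ->; rewrite ltnn.
have xr : x != star_rep x.
  apply: contraNneq ncx => xr; rewrite /center -xr eqxx /=; apply/existsP; exists y.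
  by rewrite star_backgraphE xy rxy eqxx /= -rxy -xr eqxx.
have yr : y != star_rep y.
  apply: contraNneq ncy => yr; rewrite /center -yr eqxx /=; apply/existsP; exists x.
  by rewrite star_backgraphE eq_sym xy rxy eqxx -yr /= eqxx.
have ex := noniso x ncx xr; have ey := noniso y ncy yr.
have cxy : comp y = comp x.
  by rewrite -(comp_eq (star_rep_comp x)) -(comp_eq (star_rep_comp y)) rxy.
have [st CE _ side] := star_repP ex.
have xK : x \in comp x := comp_refl x.
have yK : y \in comp x by rewrite -cxy comp_refl.
have notC z : z \in comp x -> z != star_rep x -> z \in comp x :\: C.
  move=> zK zr; rewrite inE zK andbT; apply: contra zr => zC.
  by rewrite -in_set1 -CE inE zK.
have xKC := notC x xK xr; have yKC := notC y yK; rewrite rxy in yKC.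
have {}yKC := yKC yr.
rewrite /block (negPf ncx) (negPf ncy); congr (_.*2.+1); apply/eqP.
rewrite eqn_leq last_break_mono /=; last by rewrite ltnW // rho2_lt.
apply/bigmax_leqP => -[b /= by_] bb; apply: last_break_ge => //.
case/orP: bb => [/eqP be|/existsP[c /andP[cc /eqP ce]]].
  rewrite ltnNge; apply/negP; rewrite leq_eqVlt be (negPf (rho2_neq x)) /=.
  rewrite rho2_split => xs; apply: (no_straddle st xKC yKC).
  rewrite -/pos xs ltnNge -rho2_split -leqNgt /=.
  by rewrite -be ltnW.
rewrite -ce rho2_lt in by_; rewrite -ce rho2_lt ltnNge leq_eqVlt; apply/negP.
case/predU1P=> [/pos_inj e|xc]; first by rewrite e cc in ncx.
have [e|cr] := eqVneq c (star_rep x).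
  case: side => side.
    by have := side x xK xr; rewrite -e ltnNge ltnW.
  by have := side y yK; rewrite rxy => /(_ yr); rewrite -rxy -e ltnNge ltnW.
have [ce1 ce2] : star_rep c = c /\ [exists w, B c w].
  by case/andP: cc => /eqP.
have [stc CEc _ _] := star_repP ce2.
have neK : comp c != comp x.
  by apply: contraNneq cr => e; rewrite -in_set1 -CE -e CEc ce1 set11.
have [_ [_ cond]] := G_galaxy.
apply: (cond _ _ stc st neK c x y) => //; first by rewrite CEc ce1 set11.
by rewrite -/pos xc.
Qed.

(** In the order of the blocks, the free block lies relative to [G] as [h_7] does in the product. *)
Lemma block_split x : block x != (7 + s).*2 /\
  (block x < (7 + s).*2) = (rho2 theta s x < 7 + s).
Proof.
have bp : breakpoint (7 + s) by rewrite /breakpoint eqxx.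
have ne := rho2_neq x; rewrite /block; case: ifP => _.
  by rewrite (inj_eq double_inj) ltn_double.
split; first by apply/eqP => e; have := congr1 odd e; rewrite /= !odd_double.
case: (ltnP (rho2 theta s x) (7 + s)) => [lt|ge].
  by have := last_break_lt (rho2_pos x); lia.
have : 7 + s < rho2 theta s x by rewrite ltn_neqAle eq_sym ne.
by move/(last_break_ge)/(_ bp); lia.
Qed.

End GalaxyBlocks.

(** * Embedding a right pseudogalaxy *)

Lemma Hl_embed (T : tournament) (v : nat -> T) :
  (forall i j, i < j -> j < 7 ->
     orient ((j.+1, i.+1) \notin [:: (4, 1); (6, 2); (6, 1); (5, 3); (7, 5)])
       (v i) (v j)) ->
  forall x y : Hl, edge (v (val x)) (v (val y)) = edge x y.
Proof.
move=> vE x y; rewrite /= /of_backward_edge /Hl_backward /Hl_rank !ltnS.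
case: ltngtP => [xy|yx|/val_inj ->]; last by rewrite edge_irr.
  have := vE _ _ xy (ltn_ord y); rewrite /orient.
  by case: (_ \notin _) => // /edge_asym/negPf.
have := vE _ _ yx (ltn_ord x); rewrite /orient.
by case: (_ \in _) => //= /edge_asym/negPf.
Qed.

(** The 21 pairs come in lexicographic order, each written in the direction of its edge. *)
Lemma Hl_embed7 (T : tournament) (v1 v2 v3 v4 v5 v6 v7 : T) :
  [/\ edge v1 v2, edge v1 v3, edge v4 v1, edge v1 v5 & edge v6 v1] ->
  [/\ edge v1 v7, edge v2 v3, edge v2 v4, edge v2 v5 & edge v6 v2] ->
  [/\ edge v2 v7, edge v3 v4, edge v5 v3, edge v3 v6 & edge v3 v7] ->
  [/\ edge v4 v5, edge v4 v6 & edge v4 v7] ->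
  [/\ edge v5 v6, edge v7 v5 & edge v6 v7] ->
  forall x y : Hl, edge (nth v1 [:: v1; v2; v3; v4; v5; v6; v7] (val x))
    (nth v1 [:: v1; v2; v3; v4; v5; v6; v7] (val y)) = edge x y.
Proof.
case=> e12 e13 e41 e15 e61 [e17 e23 e24 e25 e62] [e27 e34 e53 e36 e37].
case=> e45 e46 e47 [e56 e75 e67]; apply: Hl_embed => i j ij j7.
move: j7 ij; do 7?[case: j => [|j] //]; do 6?[case: i => [|i] //].
Qed.

Lemma of_backwardK (H : tournament) (f : H -> nat) x y : injective f ->
  (if f x < f y then ~~ backward f y x else (f y < f x) && backward f x y) =
  edge x y.
Proof.
move=> f_inj; have [->|xy] := eqVneq x y; first by rewrite edge_irr ltnn.
have : f x != f y by rewrite (inj_eq f_inj).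
by rewrite /backward; case: ltngtP => //= _ _; rewrite ?andbT // (edgeN xy).
Qed.

Section RightPseudogalaxies.
Variables (T : tournament) (V : {set T}) (A : nat -> {set T}).
Variables N D M K t q : nat.
Hypothesis critV : critical V K t.
Hypothesis smoothA : smooth V N D M A.
Hypotheses (q_gt0 : 0 < q) (D_gt0 : 0 < D).
Hypotheses (M_large : 16 * q ^ 2 <= M) (K_large : 16 * q * D <= K).

Variables (G : tournament) (theta : seq G) (C : {set G}) (s : nat).
Hypothesis G_galaxy : galaxy_ordering theta C.
Hypothesis s_G : s <= #|G|.
Hypothesis no_straddle : forall K, K \in stars (position theta) ->
  forall x y, x \in K :\: C -> y \in K :\: C ->
    ~ (position theta x <= s < position theta y).
Hypothesis q_G : 9 + #|G| <= q.

Let L := (8 + #|G|).*2.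
Let sigma := (7 + s).*2.
Hypothesis N_large : 7 + L + L <= N.

Let H := right_pseudogalaxy_of s G_galaxy.1.

(** The galaxy goes into the parts from [base] on, behind [h_1] to [h_6] and around [h_7], with all
    edges to and from the copy of [Hl] forward. Several vertices of [Hl] may share a part. *)
Lemma extend_Hl base (v : nat -> T) (i0 : nat -> nat) : base + L <= N ->
  (forall x y : Hl, edge (v (val x)) (v (val y)) = edge x y) ->
  (forall h, h < 7 -> v h \in A (i0 h)) ->
  (forall h, h < 6 -> i0 h < base) -> i0 6 = base + sigma ->
  contains T H.
Proof.
move=> bN vE vA i0b i06.
have sL : sigma < L by rewrite ltn_double; move: s_G; clear; lia.
have i0N h : h < 7 -> i0 h < N.
  rewrite ltnS leq_eqVlt => /predU1P[->|/i0b h6].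
    by rewrite i06; apply: leq_trans bN; rewrite ltn_add2l.
  by apply: leq_trans bN; apply: leq_trans h6 _; rewrite leq_addr.
pose P0 := [seq (i0 (val h), v (val h)) | h <- enum 'I_7].
pose ix x := base + block theta C s x.
(* Between [Hl] and [G], the order of the parts is the order of the ranks in the product. *)
have ixi (h : Hl) x : i0 (val h) != ix x /\
    (i0 (val h) < ix x) = (rho1 s h < rho2 theta s x).
  have [b1 b2] := block_split theta C s x.
  case: h => h h7; rewrite /rho1 /Hl_rank /=.
  move: (h7); rewrite ltnS leq_eqVlt => /predU1P[->|h6].
    rewrite i06 /ix eqn_add2l ltn_add2l eq_sym b1; split=> //.
    have := rho2_neq theta s x; move: b1 b2; rewrite /sigma.
    by case: ltngtP => // _ _; case: ltngtP.
  have h6b := i0b h h6; rewrite /ix h6; split.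
    by rewrite neq_ltn (leq_trans h6b (leq_addr _ _)).
  rewrite (leq_trans h6b (leq_addr _ _)); apply/esym.
  by rewrite /rho2; case: ifP => _; rewrite /position; move: h6; clear; lia.
have [phi [pA pP pE]] : exists phi : G -> T, [/\ forall x, phi x \in A (ix x),
    forall x, ok P0 (ix x) (phi x) & {mono phi : x y / edge x y}].
  apply: (@galaxy_extension T V A N D M K t q critV smoothA q_gt0 D_gt0 M_large
    K_large G (position theta) ix (star_rep theta C)).
  - exact: pos_inj G_galaxy.
  - move=> x; apply: leq_ltn_trans (pos_le G_galaxy x) _.
    by move: q_G; clear; lia.
  - move=> x; apply: leq_trans bN; rewrite ltn_add2l.
    exact: block_bound.
  - exact: star_rep_id G_galaxy.
  - exact: star_backgraphE G_galaxy.
  - by move=> x y; rewrite /ix eqn_add2l ltn_add2l; apply: block_ltE.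
  - by move=> c x cc xc; rewrite /ix eqn_add2l; apply: block_center cc xc.
  - move=> x y ncx ncy r; rewrite /ix; congr (_ + _).
    exact: (block_leaves G_galaxy no_straddle).
  - exact: v 0.
  - by apply/allP => _ /mapP[h _ ->] /=; rewrite i0N // vA.
  - rewrite size_map size_enum_ord; apply: leq_trans q_G.
    by rewrite leq_add2r.
have cross (h : Hl) x : orient (rho1 s h < rho2 theta s x) (v (val h)) (phi x).
  have [ne <-] := ixi h x; have /allP := pP x.
  move=> /(_ (i0 (val h), v (val h))); rewrite map_f ?mem_enum //=.
  by rewrite ne; apply.
apply: (@contains_embed T H
  (fun z : Hl + G => match z with inl h => v (val h) | inr x => phi x end)).
case=> [h|x] [h'|x'].
- by rewrite vE -(of_backwardK h h' (@rho1_inj s)).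
- rewrite [RHS]/= /of_backward_edge /=; have := cross h x'.
  rewrite /orient; case: ltnP => // _ /edge_asym/negPf ->.
  by rewrite andbF.
- rewrite [RHS]/= /of_backward_edge /=; have := cross h' x.
  have := rho12_disj theta s h' x.
  rewrite /orient; case: ltngtP => // _ _; last by rewrite andbF => /edge_asym/negPf.
- by rewrite pE -(of_backwardK x x' (rho2_inj (s := s) G_galaxy.1)).
Qed.

Local Notation rest := (rest A).

Lemma rest_part P b y : y \in rest P b -> y \in A b.
Proof. by rewrite inE => /andP[]. Qed.

Lemma rest_after P b y i u : y \in rest P b -> (i, u) \in P -> i < b -> edge u y.
Proof.
rewrite inE => /andP[_ /allP h] /h /=; rewrite /fwd /orient => + ib.
by rewrite ib neq_ltn ib.
Qed.

Lemma rest_before P b y i u :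
  y \in rest P b -> (i, u) \in P -> b < i -> edge y u.
Proof.
rewrite inE => /andP[_ /allP h] /h /=; rewrite /fwd /orient => + bi.
by rewrite neq_ltn bi orbT [i < b]ltnNge (ltnW bi).
Qed.

Lemma edge_parts i j x y : i < j -> j < N -> x \in A i -> y \in A j ->
  edge y x = ~~ edge x y.
Proof.
move=> ij jN xA yA.
have nij : i != j by rewrite neq_ltn ij.
have := bwdE smoothA (ltn_trans ij jN) jN nij xA yA.
by rewrite /bwd /fwd /orient ij [j < i]ltnNge (ltnW ij).
Qed.

Lemma subV j (B : {set T}) : j < N -> {subset B <= A j} -> B \subset V.
Proof. by move=> jN BA; apply: subset_trans (subA smoothA jN); apply/subsetP. Qed.

Lemma pick_candidate b P z j zs : b < N -> placed A N P -> size P <= q ->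
  j < N -> j != b -> {subset z <= A j} -> size zs <= q ->
  all (fun p => rich V K t p.2) zs ->
  exists y, [/\ y \in rest P b, light q z j b y & all (hit b y) zs].
Proof.
move=> bN plP Pq jN jb zA zq rz.
have := candidates_large critV smoothA q_gt0 D_gt0 M_large K_large
  bN plP Pq jN jb zA zq rz.
have [B0|[y]] := set_0Vmem (candidates A q b P z j zs); last first.
  by rewrite inE => /and3P[? ? ?] _; exists y.
(* Without candidates [V] would be empty, but it contains a rich chain. *)
rewrite B0 cards0 muln0 leqn0 => /eqP V0.
have [z' [_ /andP[cz' tz'] _]] := rest_rich critV smoothA q_gt0 D_gt0 M_large
  K_large bN (isT : placed A N [::]) (leq0n q).
have := chain_card cz'; rewrite V0 leqn0 => /eqP s0.
by move: tz'; rewrite s0 muln0.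
Qed.

(** A rich chain among the vertices left in [A c] is hit by some vertex left in [A b]. *)
Lemma pick_back_edge P b c : b < N -> c < N -> b != c -> placed A N P ->
  size P <= q -> exists x y,
    [/\ x \in rest P b, y \in rest P c & ~~ fwd b c x y].
Proof.
move=> bN cN bc plP Pq; have [z [/andP[_ /allP zR] rz _]] :=
  rest_rich critV smoothA q_gt0 D_gt0 M_large K_large cN plP Pq.
have [||||x [xR _]] := @pick_candidate b P [::] c [:: (c, z)] bN plP Pq cN => //.
- by rewrite eq_sym.
- by rewrite /= rz.
rewrite /= andbT => /hasP[y /zR yR bxy]; by exists x, y.
Qed.

(* With respect to 2,4,1,5,3,6,7, the backward edges of [Hl] are the triangle
   2,1,6 (here [u, v, w]) and the edges 3-4 and 5-7. *)
Lemma triangle_contains base i a j b c k u v w :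
  [/\ i < a, a < j, j < b, b < c & c < k] -> k < base -> base + L <= N ->
  u \in A i -> v \in A j -> w \in A k ->
  edge v u -> edge w u -> edge w v -> contains T H.
Proof.
case=> ia aj jb bc ck kb bN uA vA wA vu wu wv.
have sL : sigma < L by rewrite ltn_double; move: s_G; clear; lia.
have lt_neq (m n : nat) : m < n -> m != n by rewrite neq_ltn => ->.
(* The parts [i], [a], [j], [b], [c], [k], [l] receive the vertices 2, 4, 1, 5, 3, 6, 7 in this
   order. *)
pose l := base + sigma.
have kl : k < l by apply: leq_trans kb (leq_addr _ _).
have lN : l < N by apply: leq_trans bN; rewrite ltn_add2l.
have q9 : 9 <= q by apply: leq_trans q_G; rewrite leq_addr.
pose P1 := [:: (i, u); (j, v); (k, w)].
have [aj' ab ac ak al] : [/\ i < j, a < b, a < c, a < k & a < l].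
  by move: aj jb bc ck kl ia; clear; split; lia.
have [jc jk jl ik il] : [/\ j < c, j < k, j < l, i < k & i < l].
  by move: aj jb bc ck kl ia; clear; split; lia.
have [bk bl cl ib ic] : [/\ b < k, b < l, c < l, i < b & i < c].
  by move: aj jb bc ck kl ia; clear; split; lia.
have [iN aN jN bN' cN] : [/\ i < N, a < N, j < N, b < N & c < N].
  by move: al il jl bl cl lN; clear; split; lia.
have kN := ltn_trans kl lN.
have P1q : size P1 <= q by apply: leq_trans q9.
have pl1 : placed A N P1 by rewrite /placed /= uA vA wA iN jN kN.
have [x4 [x3 [x4R x3R b43]]] := pick_back_edge aN cN (lt_neq _ _ ac) pl1 P1q.
pose P2 := [:: (a, x4), (c, x3) & P1].
have x4A := rest_part x4R; have x3A := rest_part x3R.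
have pl2 : placed A N P2.
  by rewrite /placed /= uA vA wA iN jN kN x4A x3A aN cN.
have P2q : size P2 <= q by apply: leq_trans q9.
have [x5 [x7 [x5R x7R b57]]] := pick_back_edge bN' lN (lt_neq _ _ bl) pl2 P2q.
have x5A := rest_part x5R; have x7A := rest_part x7R.
have m1 p : p \in P1 -> p \in P2 by rewrite !inE => ->; rewrite !orbT.
have mu : (i, u) \in P1 by rewrite inE eqxx.
have mv : (j, v) \in P1 by rewrite !inE eqxx orbT.
have mw : (k, w) \in P1 by rewrite !inE eqxx !orbT.
have m4 : (a, x4) \in P2 by rewrite inE eqxx.
have m3 : (c, x3) \in P2 by rewrite !inE eqxx orbT.
have e34 : edge x3 x4.
  by rewrite (edge_parts ac cN x4A x3A); move: b43; rewrite /fwd /orient ac.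
have e75 : edge x7 x5.
  by rewrite (edge_parts bl lN x5A x7A); move: b57; rewrite /fwd /orient bl.
apply: (@extend_Hl base (nth v [:: v; u; x3; x4; x5; w; x7])
  (nth 0 [:: j; i; c; a; b; k; l])) => //.
- apply: Hl_embed7; split=> //.
  + exact: rest_after x3R mv jc.
  + exact: rest_before x4R mv aj.
  + exact: rest_after x5R (m1 _ mv) jb.
  + exact: rest_after x7R (m1 _ mv) jl.
  + exact: rest_after x3R mu ic.
  + exact: rest_after x4R mu ia.
  + exact: rest_after x5R (m1 _ mu) ib.
  + exact: rest_after x7R (m1 _ mu) il.
  + exact: rest_before x5R m3 bc.
  + exact: rest_before x3R mw ck.
  + exact: rest_after x7R m3 cl.
  + exact: rest_after x5R m4 ab.
  + exact: rest_before x4R mw ak.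
  + exact: rest_after x7R m4 al.
  + exact: rest_before x5R (m1 _ mw) bk.
  + exact: rest_after x7R (m1 _ mw) kl.
- by move=> h; do 7?[case: h => [|h] //].
- have ltb m : m < k -> m < base by move=> mk; apply: ltn_trans kb.
  by move=> h; do 6?[case: h => [|h] //=] => _; rewrite ?ltb.
Qed.

(* The vertices 1, 5 and 6 are placed in parts 0, 4 and 6, the vertices 2, 3, 4
   in a transitive set in part 2, and 7 inside the first of two sequences of
   blocks; triangles with 7 are excluded by means of the second one. *)
Lemma critical_contains : ~ ~ contains T H.
Proof.
move=> nH.
(* Two successive backward edges force the third pair forward. The parts [a], [b], [c] leave space
   for 4, 5, 3 in the copy built from a triangle. *)
have noT base i a j b c k u v w : [/\ i < a, a < j, j < b, b < c & c < k] ->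
    k < base -> base + L <= N -> u \in A i -> v \in A j -> w \in A k ->
    edge v u -> edge w v -> edge u w.
  move=> idx kb bN uA vA wA vu wv; apply: contraT => uw; exfalso; apply: nH.
  apply: (triangle_contains idx kb bN uA vA wA) => //.
  have ik : i < k by case: idx; clear; lia.
  rewrite (edge_parts ik _ uA wA) //; apply: leq_trans kb _.
  by apply: leq_trans bN; apply: leq_addr.
have sL : sigma < L by rewrite ltn_double; move: s_G; clear; lia.
pose l := 7 + sigma.
have lL : l < 7 + L by rewrite ltn_add2l.
have N1 : 7 + L <= N by apply: leq_trans N_large; apply: leq_addr.
have lN : l < N by apply: leq_trans N1.
have N7 : 7 < N by apply: leq_ltn_trans lN; apply: leq_addr.
have [N0 N2 N4 N6] : [/\ 0 < N, 2 < N, 4 < N & 6 < N] by split; apply: leq_trans N7.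
have q9 : 9 <= q by apply: leq_trans q_G; rewrite leq_addr.
have A2V : #|V| <= K * #|A 2|.
  have VA : #|V| <= D * #|A 2| by case: smoothA => /(_ 2 N2)[].
  apply: leq_trans VA _; rewrite leq_mul2r; apply/orP; right.
  apply: leq_trans K_large; rewrite leq_pmull // muln_gt0 q_gt0.
  by [].
have [z [cz rz zs]] := large_rich critV q_gt0 D_gt0 K_large (subA smoothA N2) A2V.
have zA : {subset z <= A 2} by case/andP: cz => _ /allP.
have czV : chain V z by case/andP: rz.
pose room P i := filter (ok P 2) (piece q z i).
have room_rich P i : i < q -> size P <= q ->
    all (fun p => (p.1 != 2) ==> light q z 2 p.1 p.2) P -> rich V K t (room P i).
  exact: (piece_rich critV q_gt0 D_gt0 K_large czV zs).
have roomP P i x : x \in room P i ->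
    [/\ x \in piece q z i, x \in A 2 & x \in rest P 2].
  rewrite mem_filter => /andP[okx xp]; have xA := zA x (piece_sub xp).
  by rewrite inE xA okx.
have r2 : rich V K t (room [::] 0) by apply: room_rich => //; apply: leq_trans q9.
have r4 : rich V K t (room [::] 2) by apply: room_rich => //; apply: leq_trans q9.
(* Possible choices of 6 with a backward edge into piece 0, the place of 2. They are numerous enough
   to contain a rich chain, which 1 can hit in turn. *)
pose S6 := candidates A q 6 [::] z 2 [:: (2, room [::] 0)].
have S6K : #|V| <= K * #|S6|.
  apply: (candidates_large critV smoothA q_gt0 D_gt0 M_large K_large) => //.
  by rewrite /= r2.
have S6V : S6 \subset V.
  by apply: (@subV 6) => // y; rewrite inE => /andP[/rest_part].
have [z6 [cz6 rz6 _]] := large_rich critV q_gt0 D_gt0 K_large S6V S6K.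
(* Choosing 1 to hit both piece 2, the place of 4, and the chain of choices of 6 yields the whole
   path 4-1-6-2. *)
have [||x1 [x1R l1]] := @pick_candidate 0 [::] z 2 [:: (2, room [::] 2); (6, z6)]
    N0 isT (leq0n q) N2 isT zA.
- by apply: leq_trans q9.
- by rewrite /= r4 rz6.
rewrite /= andbT => /andP[/hasP[x4 x4r h14] /hasP[x6 x6z h16]].
have : x6 \in S6.
  by case/andP: cz6 => _ /allP; apply.
rewrite inE /= andbT => /and3P[x6R l6 /hasP[x2 x2r h62]].
have [x4p x4A _] := roomP _ _ _ x4r; have [x2p x2A _] := roomP _ _ _ x2r.
have x1A := rest_part x1R; have x6A := rest_part x6R.
have e41 : edge x4 x1 by rewrite (@edge_parts 0 2).
have e61 : edge x6 x1 by rewrite (@edge_parts 0 6).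
have e62 : edge x6 x2 by rewrite (@edge_parts 2 6).
have e24 : edge x2 x4 by apply: (piece_edge (q := q) czV _ x2p x4p).
(* Otherwise 1, 2, 6 form a backward triangle; likewise 1, 4, 6 for the pair 4, 6 below. *)
have e12 : edge x1 x2.
  rewrite -[edge x1 x2]negbK -(@edge_parts 0 2) //; apply/negP => e21.
  have /edge_asym := noT (7 + L) 0 1 2 3 4 6 _ _ _
    (And5 isT isT isT isT isT) isT N_large x1A x2A x6A e21 e62.
  by rewrite e61.
have e46 : edge x4 x6.
  rewrite -[edge x4 x6]negbK -(@edge_parts 2 6) //; apply/negP => e64.
  have /edge_asym := noT (7 + L) 0 1 2 3 4 6 _ _ _
    (And5 isT isT isT isT isT) isT N_large x1A x4A x6A e41 e64.
  by rewrite e61.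
pose P := [:: (0, x1); (6, x6); (2, x2); (2, x4)].
have plP : placed A N P by rewrite /placed /= x1A x2A x4A x6A N0 N2 N6.
have Pq : size P <= q by apply: leq_trans q9.
(* Since 1 and 6 are light, piece 1, between those of 2 and 4, is still rich and can hold 3. *)
have r3 : rich V K t (room P 1).
  by apply: room_rich => //=; [apply: leq_trans q9|rewrite l1 l6].
have [z7 [/andP[_ /allP z7R] rz7 _]] :=
  rest_rich critV smoothA q_gt0 D_gt0 M_large K_large lN plP Pq.
(* Now 5 hits the place of 3 and a chain for 7, which gives the path 3-5-7. *)
have [|||x5 [x5R _]] := @pick_candidate 4 P [::] 2 [:: (2, room P 1); (l, z7)]
    N4 plP Pq N2 isT => //.
- by apply: leq_trans q9.
- by rewrite /= r3 rz7.
rewrite /= andbT => /andP[/hasP[x3 x3r h53] /hasP[x7 x7z h57]].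
have [x3p x3A x3R] := roomP _ _ _ x3r; have x7R := z7R _ x7z.
have x5A := rest_part x5R; have x7A := rest_part x7R.
have l2 : 2 < l by rewrite /l.
have e53 : edge x5 x3 by rewrite (@edge_parts 2 4).
have e75 : edge x7 x5 by rewrite (@edge_parts 4 l).
have e37 : edge x3 x7.
  exact: (noT (7 + L) 2 3 4 5 6 l _ _ _ (And5 isT isT isT isT isT) lL N_large
    x3A x5A x7A e53 e75).
have m1 : (0, x1) \in P by rewrite inE eqxx.
have m6 : (6, x6) \in P by rewrite !inE eqxx orbT.
have m2 : (2, x2) \in P by rewrite !inE eqxx !orbT.
have m4 : (2, x4) \in P by rewrite !inE eqxx !orbT.
apply: nH; apply: (@extend_Hl 7 (nth x1 [:: x1; x2; x3; x4; x5; x6; x7])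
  (nth 0 [:: 0; 2; 2; 2; 4; 6; l])) => //.
- apply: Hl_embed7; split=> //.
  + exact: rest_after x3R m1 _.
  + exact: rest_after x5R m1 _.
  + exact: rest_after x7R m1 _.
  + exact: (piece_edge (q := q) czV _ x2p x3p).
  + exact: rest_after x5R m2 _.
  + exact: rest_after x7R m2 _.
  + exact: (piece_edge (q := q) czV _ x3p x4p).
  + exact: rest_before x3R m6 _.
  + exact: rest_after x5R m4 _.
  + exact: rest_after x7R m4 _.
  + exact: rest_before x5R m6 _.
  + exact: rest_after x7R m6 _.
- by move=> h; do 7?[case: h => [|h] //].
- by move=> h; do 6?[case: h => [|h] //].
Qed.

End RightPseudogalaxies.

(** * The exponent *)

Section Exponent.
Variable R : realType.
Local Open Scope ring_scope.

(* Small enough for both [K `^ eps <= K / (K - 1)] and [(2 ^ K) `^ eps <= 2]. *)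
Definition eh_exponent K : R := (K%:R ^+ 2)^-1.

Lemma eh_exponent_gt0 K : (0 < K)%N -> 0 < eh_exponent K.
Proof. by move=> K0; rewrite invr_gt0 exprn_gt0 // ltr0n. Qed.

(** From [ln K <= K] the power is at most [expR (1 / K)], while [1 - 1 / K <= expR (- 1 / K)]. *)
Lemma powR_eh_exponent K : (1 < K)%N ->
  K%:R `^ eh_exponent K * K.-1%:R <= K%:R :> R.
Proof.
move=> K1; have K0 : 0 < K%:R :> R by rewrite ltr0n ltnW.
rewrite /powR (gt_eqF K0) -subn1 natrB ?(ltnW K1) //.
have le1 : eh_exponent K * ln K%:R <= K%:R^-1 :> R.
  rewrite /eh_exponent expr2 invfM -mulrA ger_pMr ?invr_gt0 //.
  by rewrite mulrC ler_pdivrMr // mul1r ltW // ln_sublinear.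
have le2 : 1 - K%:R^-1 <= expR (- K%:R^-1) :> R by apply: expR_ge1Dx.
have -> : K%:R - 1 = K%:R * (1 - K%:R^-1) :> R.
  by rewrite mulrBr mulr1 mulfV ?gt_eqF.
rewrite mulrCA ger_pMr //.
apply: le_trans (_ : expR (K%:R^-1) * expR (- K%:R^-1) <= 1).
  apply: ler_pM; rewrite ?expR_ge0 ?ler_expR // subr_ge0 invf_le1 //.
  by rewrite ler1n ltnW.
by rewrite -expRD subrr expR0.
Qed.

Lemma powR_small K n : (1 < K)%N -> (n <= 2 ^ K)%N ->
  n%:R `^ eh_exponent K <= 2 :> R.
Proof.
move=> K1 nK; have K0 : 0 < K%:R :> R by rewrite ltr0n ltnW.
apply: le_trans (_ : (2 ^ K)%N%:R `^ eh_exponent K <= 2).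
  apply: ge0_ler_powR; rewrite ?nnegrE ?ler0n ?ler_nat //.
  by rewrite ltW // eh_exponent_gt0 // ltnW.
rewrite natrX -powR_mulrn // -powRrM -[leRHS](powRr1 (ler0n _ 2)).
apply: ler_powR; first by rewrite ler1n.
by rewrite /eh_exponent expr2 invfM mulrA mulfV ?gt_eqF // mul1r invf_le1 // ler1n ltnW.
Qed.

End Exponent.

(** * From minimal counterexamples to the theorem *)

Lemma max_chain (T : tournament) (V : {set T}) :
  exists2 s, chain V s & forall s', chain V s' -> size s' <= size s.
Proof.
pose P n := [exists s : n.-tuple T, chain V s].
have exP : exists n, P n by exists 0; apply/existsP; exists [tuple].
have ubP n : P n -> n <= #|V|.
  by case/existsP=> s /chain_card; rewrite size_tuple.
have [n /existsP[s cs] max] := ex_maxnP exP ubP.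
exists s => // s' cs'; rewrite size_tuple; apply: max.
by apply/existsP; exists (in_tuple s').
Qed.

(** Strong induction on [#|V|]: a first failure [V], with [t] the size of a longest chain, would be
    critical. *)
Lemma large_chain (R : realType) (H T : tournament) K :
  1 < K ->
  (forall (V : {set T}) t, critical V K t -> ~ ~ contains T H) ->
  ~ contains T H -> forall V : {set T},
  exists2 s, chain V s & (#|V|%:R `^ eh_exponent R K <= (size s)%:R :> R)%R.
Proof.
move=> K1 noncritical nTH V; have K0 := ltnW K1.
have eps0 := eh_exponent_gt0 R K0; set eps := eh_exponent R K in eps0 *.
elim: {V}#|V| {-2}V (leqnn #|V|) => [|n IH] V.
  rewrite leqn0 => /eqP ->; exists [::] => //.
  by rewrite powR0 ?gt_eqF.
rewrite leq_eqVlt => /predU1P[Vn|]; last exact: IH.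
have [s0 cs0 max0] := max_chain V; set t := size s0 in max0.
have [le|lt] := leP (#|V|%:R `^ eps)%R (t%:R : R)%R; first by exists s0.
exfalso; apply: (noncritical V t _ nTH); split=> //.
- move=> B BV KB; have [e|ne] := eqVneq #|B| #|V|.
    have -> : B = V by apply/eqP; rewrite eqEcard BV e leqnn.
    by exists s0 => //; rewrite -/t leq_addr.
  have Bn : #|B| <= n.
    by rewrite -ltnS -Vn ltn_neqAle ne subset_leq_card.
  have [s cs le] := IH B Bn; exists s => //.
  have : (t%:R * K.-1%:R <= (size s)%:R * K%:R :> R)%R.
    apply: le_trans (_ : (#|V|%:R `^ eps * K.-1%:R <= _)%R).
      by rewrite ler_wpM2r ?ler0n // ltW.
    apply: le_trans (_ : ((K * #|B|)%N%:R `^ eps * K.-1%:R <= _)%R).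
      rewrite ler_wpM2r ?ler0n //.
      by apply: ge0_ler_powR; rewrite ?nnegrE ?ler0n ?ler_nat // ltW.
    rewrite natrM powRM ?ler0n // mulrAC mulrC.
    by apply: ler_pM; rewrite ?powR_ge0 ?mulr_ge0 ?powR_ge0 ?ler0n ?powR_eh_exponent.
  by rewrite -!natrM ler_nat; clear -K0; nia.
(* If [t < K], then [#|V| <= 2 ^ K], so [t < 2]; this forces [#|V| = 1], where a single vertex is
   already a long enough chain. *)
- rewrite leqNgt; apply/negP => tK.
  have V2K : #|V| <= 2 ^ K.
    rewrite leqNgt; apply/negP => /ltnW /ramsey_chain[s /max0 le1 le2].
    by have := leq_trans le2 le1; rewrite ltnNge (ltnW tK).
  have t2 : t < 2.
    by rewrite -(ltr_nat R); apply: lt_le_trans lt _; apply: powR_small.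
  have V1 : #|V| = 1.
    apply/eqP; rewrite eqn_leq Vn andbT -Vn leqNgt; apply/negP => V2.
    have [s /max0 le1 le2] := @ramsey_chain T 1 V V2.
    by have := leq_trans le2 le1; rewrite leqNgt t2.
  have [s /max0 le1 le2] := @ramsey_chain T 0 V (eq_leq (esym V1)).
  move: lt; rewrite V1 powR1 (ltr_nat R t 1) ltnNge.
  by rewrite (leq_trans le2 le1).
Qed.

Lemma contains_iso (T H H' : tournament) :
  isomorphic H H' -> contains T H' -> contains T H.
Proof.
case=> phi bphi mphi [S [psi bpsi mpsi]]; exists S, (psi \o phi).
  exact: bij_comp.
by move=> x y; rewrite -mphi -mpsi.
Qed.

Theorem theorem15 (R : realType) (H : tournament) (hH : right_pseudogalaxy H) :
  erdos_hajnal R H.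
Proof.
case: hH => G [theta [C [s [G_galaxy [/andP[_ s_G] no_straddle iso]]]]].
pose H' := right_pseudogalaxy_of s G_galaxy.1.
(* [q] exceeds the number of vertices placed and the ranks in [G]. The [7 + L + L] parts are seven
   initial ones and two sequences of [L] blocks. *)
pose q := 9 + #|G|; pose L := (8 + #|G|).*2; pose M := 16 * q ^ 2.
have [D D0 fam] := @smooth_family H' M (7 + L + L) isT.
pose K := 16 * q * D.
have K1 : 1 < K by rewrite /K /q; clear -D0; nia.
have DK : D < K by rewrite /K /q; clear -D0; nia.
exists (eh_exponent R K); first exact/eh_exponent_gt0/ltnW.
move=> T nTH.
have nTH' : ~ contains T H' by move/(contains_iso iso).
have [|s0 cs0 le] := @large_chain R H' T K K1 _ nTH' setT; last first.
  exists [set x in s0]; first exact: chain_transitive cs0.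
  by rewrite cardsE (card_uniqP (chain_uniq cs0)) -cardsT.
move=> V t crit.
(* As [t >= K > D], a chain of almost [t] vertices in [V] suffices. *)
have DV : D <= #|V|.
  have [large _ Kt] := crit.
  have [|s0 /chain_card sV Ks] := large V (subxx V); first by rewrite leq_pmull // ltnW.
  move: (size s0) (#|V|) sV Ks => m n mn Ks; move: DK Kt mn Ks K1; clear; nia.
have [A smoothA] := fam T nTH' V DV.
exact: (critical_contains (q := q) crit smoothA isT D0 (leqnn _) (leqnn _)
  s_G no_straddle (leqnn _) (leqnn _)).
Qed.
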